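(* Let $(S,\mathfrak n,k)$ be a complete regular local ring, let $0\neq f\in\mathfrak n^2$, let $A=S[\![u,v]\!]/(f+uv)$, and let $N$ be a maximal Cohen-Macaulay $A$-module. Then for $z$ either of $u$ or $v$, $$\mathrm{syz}_1^A(N/zN)\cong N\oplus \mathrm{syz}_1^A(N),$$ with no hypothesis on the characteristic of $k$.
   Context: All modules are finitely generated; $\mathrm{syz}_1^A(X)$ denotes the first syzygy of $X$ over the local ring $A$, i.e. the kernel of a minimal free cover of $X$. $S$ need not contain a field. *)

(* Defs.v *)
From HB Require Import structures.
From mathcomp Require Import all_boot all_order all_algebra.
From mathcomp Require Import boolp classical_sets functions.

Set Implicit Arguments.
Unset Strict Implicit.
Unset Printing Implicit Defensive.

Import GRing.Theory.
Local Open Scope ring_scope.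
Local Open Scope classical_set_scope.
Local Open Scope quotient_scope.

Section Spans.
Variables (R : comNzRingType) (M : lmodType R).

Definition lspan k (g : 'I_k -> M) : set M :=
  [set x | exists c : 'I_k -> R, x = \sum_(i < k) c i *: g i].

Definition fin_gen : Prop := exists k (g : 'I_k -> M), lspan g = setT.

End Spans.

Arguments fin_gen {R} M.

Section Ideals.
Variable R : comNzRingType.
Implicit Types I J m : set R.

Definition is_ideal I : Prop :=
  [/\ I 0, forall x y, I x -> I y -> I (x + y) & forall a x, I x -> I (a * x)].

Definition maximal_ideal m : Prop :=
  [/\ is_ideal m, ~ m 1 &
      forall J, is_ideal J -> ~ J 1 -> m `<=` J -> J = m].

Definition prime_ideal I : Prop :=
  [/\ is_ideal I, ~ I 1 & forall x y, I (x * y) -> I x \/ I y].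

Definition noetherian : Prop :=
  forall I, is_ideal I -> exists k (g : 'I_k -> R^o), I = lspan g.

(* Local rings are Noetherian by convention. *)
Definition local_ring m : Prop :=
  [/\ noetherian, maximal_ideal m & forall m', maximal_ideal m' -> m' = m].

Definition prime_chain d : Prop :=
  exists p : 'I_d.+1 -> set R,
    (forall i, prime_ideal (p i)) /\
    (forall i j : 'I_d.+1, (i < j)%N -> p i `<` p j).

Definition krull_dim d : Prop :=
  prime_chain d /\ forall e, prime_chain e -> (e <= d)%N.

(* m is generated by dim R elements; meant for local_ring m. *)
Definition regular m : Prop :=
  exists d, krull_dim d /\ exists g : 'I_d -> R^o, m = lspan g.

Definition ideal_mul I J : set R :=
  [set x | exists k (a b : 'I_k -> R),
    [/\ forall i, I (a i), forall i, J (b i) & x = \sum_(i < k) a i * b i]].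

Definition ideal_pow I k : set R := iter k (ideal_mul I) setT.

(* The canonical map R -> lim_k R/m^k is bijective. *)
Definition adic_complete m : Prop :=
  (forall x, (forall k, ideal_pow m k x) -> x = 0) /\
  (forall x : nat -> R, (forall k, ideal_pow m k (x k.+1 - x k)) ->
     exists l, forall k, ideal_pow m k (l - x k)).

End Ideals.

Arguments krull_dim : clear implicits.

Section Depth.
Variables (R : comNzRingType) (m : set R) (M : lmodType R).

(* The submodule (s_0, ..., s_(r-1)) M. *)
Definition seq_mul (s : seq R) : set M :=
  [set x | exists y : 'I_(size s) -> M, x = \sum_(i < size s) s`_i *: y i].

(* The second clause says that s_i is a nonzerodivisor on
   M / (s_0, ..., s_(i-1)) M, the third one that M / s M is nonzero. *)
Definition regular_seq (s : seq R) : Prop :=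
  [/\ forall i, (i < size s)%N -> m s`_i,
      forall i, (i < size s)%N ->
        forall x, seq_mul (take i s) (s`_i *: x) -> seq_mul (take i s) x
    & exists x, ~ seq_mul s x].

Definition depth d : Prop :=
  (exists s, regular_seq s /\ size s = d) /\
  (forall s, regular_seq s -> (size s <= d)%N).

End Depth.

(* Maximal Cohen-Macaulay: R is local, M is finitely generated and
   depth M = dim R.  As M / s M != 0 is part of regular_seq, M is nonzero. *)
Definition maximal_CM (R : comNzRingType) (M : lmodType R) : Prop :=
  fin_gen M /\
  exists (m : set R) (d : nat),
    [/\ local_ring m, krull_dim R d & depth m M d].

Definition lmod_iso (R : comNzRingType) (U V : lmodType R) : Prop :=
  exists g : {linear U -> V}, bijective g.

Section Kernel.
Variables (R : comNzRingType) (U V : lmodType R) (phi : {linear U -> V}).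

Definition in_ker : {pred U} := fun x => phi x == 0.

Lemma in_ker_submod : submod_closed in_ker.
Proof.
split=> [|a x y]; rewrite !unfold_in ?linear0 // => /eqP x0 /eqP y0.
by rewrite linearP x0 y0 scaler0 addr0.
Qed.

HB.instance Definition _ := GRing.isSubmodClosed.Build R U in_ker in_ker_submod.

Record kernel : Type := Kernel {ker_val : U; _ : ker_val \in in_ker}.

HB.instance Definition _ := [isSub for ker_val].
HB.instance Definition _ := [Choice of kernel by <:].
HB.instance Definition _ := [SubChoice_isSubLmodule of kernel by <:].

End Kernel.

(* A free cover R^k -> M of the least possible rank; the first syzygy of M is
   the kernel of such a map. *)
Definition minimal_free_cover (R : comNzRingType) (M : lmodType R) k
    (phi : {linear 'rV[R]_k -> M}) : Prop :=
  range phi = setT /\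
  forall l (psi : {linear 'rV[R]_l -> M}), range psi = setT -> (k <= l)%N.

Section QuotBy.
Variables (R : comNzRingType) (M : lmodType R) (z : R).

Definition zmul : {pred M} := fun x => `[< exists y, x = z *: y >].

Lemma zmul_submod : submod_closed zmul.
Proof.
split=> [|a x y]; first by apply/asboolP; exists 0; rewrite scaler0.
move=> /asboolP[x' ->] /asboolP[y' ->]; apply/asboolP; exists (a *: x' + y').
by rewrite scalerDr !scalerA mulrC.
Qed.

HB.instance Definition _ := GRing.isSubmodClosed.Build R M zmul zmul_submod.

Definition quot_by : Type := Quotient.quot zmul.

HB.instance Definition _ := GRing.Zmodule.on quot_by.

Definition quot_by_pi (x : M) : quot_by := \pi_(Quotient.quot zmul) x.

Lemma quot_by_piP x y : quot_by_pi x = quot_by_pi y <-> x - y \in zmul.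
Proof.
rewrite (Quotient.idealrBE (zmul : zmodClosed M)).
by split=> [/eqP|/eqP].
Qed.

Lemma quot_by_piD x y : quot_by_pi (x + y) = quot_by_pi x + quot_by_pi y.
Proof. exact: (raddfD \pi_(Quotient.quot zmul)). Qed.

Lemma quot_by_pi_surj (x : quot_by) : quot_by_pi (repr (x : Quotient.quot zmul)) = x.
Proof. exact: reprK. Qed.

Definition quot_by_scale (a : R) (x : quot_by) : quot_by :=
  quot_by_pi (a *: repr (x : Quotient.quot zmul)).

Lemma quot_by_scaleE a x : quot_by_scale a (quot_by_pi x) = quot_by_pi (a *: x).
Proof.
apply/quot_by_piP; rewrite -scalerBr; apply: rpredZ.
by apply/quot_by_piP; rewrite quot_by_pi_surj.
Qed.

Lemma quot_by_scaleA a b x :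
  quot_by_scale a (quot_by_scale b x) = quot_by_scale (a * b) x.
Proof. by rewrite -[x]quot_by_pi_surj !quot_by_scaleE scalerA. Qed.

Lemma quot_by_scale1 : left_id 1 quot_by_scale.
Proof. by move=> x; rewrite -[x]quot_by_pi_surj quot_by_scaleE scale1r. Qed.

Lemma quot_by_scaleDr : right_distributive quot_by_scale +%R.
Proof.
move=> a x y; rewrite -[x]quot_by_pi_surj -[y]quot_by_pi_surj -quot_by_piD.
by rewrite !quot_by_scaleE -quot_by_piD scalerDr.
Qed.

Lemma quot_by_scaleDl x : {morph quot_by_scale^~ x : a b / a + b}.
Proof.
move=> a b; rewrite -[x]quot_by_pi_surj.
by rewrite !quot_by_scaleE -quot_by_piD scalerDl.
Qed.

HB.instance Definition _ := GRing.Zmodule_isLmodule.Build R quot_by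
  quot_by_scaleA quot_by_scale1 quot_by_scaleDr quot_by_scaleDl.

Lemma quot_by_pi_is_linear : linear quot_by_pi.
Proof.
move=> a x y; rewrite quot_by_piD; congr (_ + _).
by rewrite -[RHS]/(quot_by_scale _ _) quot_by_scaleE.
Qed.

HB.instance Definition _ :=
  GRing.isLinear.Build R M quot_by _ quot_by_pi quot_by_pi_is_linear.

End QuotBy.

Arguments zmul {R} M z.
Arguments quot_by {R} M z.

Lemma fin_gen_quot_by (R : comNzRingType) (M : lmodType R) (z : R) :
  fin_gen M -> fin_gen (quot_by M z).
Proof.
move=> [k [g gM]]; exists k, (fun i => quot_by_pi z (g i)).
apply/seteqP; split=> // x _.
have : setT (repr (x : Quotient.quot (zmul M z))) by [].
rewrite -gM => -[c xE]; exists c.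
rewrite -[LHS]quot_by_pi_surj xE linear_sum /=.
by apply: eq_bigr => i _; rewrite linearZ.
Qed.

Lemma minimal_free_cover_exists (R : comNzRingType) (M : lmodType R) :
  fin_gen M ->
  exists k (phi : {linear 'rV[R]_k -> M}), minimal_free_cover phi.
Proof.
pose P k := `[< exists phi : {linear 'rV[R]_k -> M}, range phi = setT >].
move=> [k [g gM]].
have exP : exists k, P k.
  exists k; apply/asboolP.
  pose h (c : 'rV[R]_k) : M := \sum_i c 0 i *: g i.
  have h_lin : linear h.
    move=> a x y; rewrite /h scaler_sumr -big_split /=.
    by apply: eq_bigr => i _; rewrite !mxE scalerDl scalerA.
  pose hL := GRing.isLinear.Build R 'rV[R]_k M _ h h_lin.
  pose phi : {linear 'rV[R]_k -> M} := HB.pack h hL.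
  exists phi.
  apply/seteqP; split=> // x _.
  have : setT x by [].
  rewrite -gM => -[c ->]; exists (\row_i c i) => //=.
  by apply: eq_bigr => i _; rewrite mxE.
case: (ex_minnP exP) => l /asboolP[phi phiM] lmin.
exists l, phi; split=> // j psi psiM.
by apply: lmin; apply/asboolP; exists psi.
Qed.

(* Formal power series in one variable, as coefficient sequences. *)
Definition powser (R : Type) : Type := nat -> R.

Section PowerSeries.
Variable R : comNzRingType.

HB.instance Definition _ := GRing.Zmodule.copy (powser R) (nat -> R).

Implicit Types f g h : powser R.

Definition ps_mul f g : powser R :=
  fun n => \sum_(i < n.+1) f i * g (n - i)%N.

Definition psC (c : R) : powser R := fun n => if n == 0%N then c else 0.

Definition psX : powser R := fun n => (n == 1%N)%:R.

Let trunc N f : {poly R} := \poly_(i < N) f i.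

Let ps_mulE N f g n :
  (n < N)%N -> ps_mul f g n = (trunc N f * trunc N g)`_n.
Proof.
move=> nN; rewrite coefM; apply: eq_bigr => i _.
have iN : (i < N)%N by apply: leq_ltn_trans nN; rewrite -ltnS.
by rewrite !coef_poly iN (leq_ltn_trans (leq_subr _ _) nN).
Qed.

Let truncE N f n : (n < N)%N -> (trunc N f)`_n = f n.
Proof. by rewrite coef_poly => ->. Qed.

Lemma ps_mulC : commutative ps_mul.
Proof.
by move=> f g; apply/funext => n; rewrite !(ps_mulE _ _ (ltnSn n)) mulrC.
Qed.

Lemma ps_mulA : associative ps_mul.
Proof.
move=> f g h; apply/funext => n.
transitivity (trunc n.+1 f * (trunc n.+1 g * trunc n.+1 h))`_n.
  rewrite coefM; apply: eq_bigr => i _; rewrite truncE //.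
  by rewrite -ps_mulE // ltnS leq_subr.
rewrite mulrA coefM; apply: eq_bigr => i _; rewrite -ps_mulE //.
by rewrite truncE // ltnS leq_subr.
Qed.

Lemma ps_mul1 : left_id (psC 1) ps_mul.
Proof.
move=> f; apply/funext => n; rewrite /ps_mul big_ord_recl /= subn0 mul1r.
by rewrite big1 ?addr0 // => i _; rewrite /psC /= mul0r.
Qed.

Lemma ps_mulDl : left_distributive ps_mul +%R.
Proof.
move=> f g h; apply/funext => n.
rewrite /ps_mul -[RHS]/(_ + _) -big_split /=.
by apply: eq_bigr => i _; rewrite -mulrDl.
Qed.

Lemma psC1_neq0 : psC 1 != 0.
Proof. by apply/eqP => /(congr1 (@^~ 0%N)) /eqP; rewrite oner_eq0. Qed.

HB.instance Definition _ := GRing.Zmodule_isComNzRing.Build (powser R)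
  ps_mulA ps_mulC ps_mul1 ps_mulDl psC1_neq0.

Lemma ps_coefM f g n : (f * g) n = \sum_(i < n.+1) f i * g (n - i)%N.
Proof. by []. Qed.

Lemma ps_coefD f g n : (f + g) n = f n + g n.
Proof. by []. Qed.

End PowerSeries.

Arguments psX {R}.

Section PowerSeries2.
Variable S : comNzRingType.

(* S[[u,v]] as S[[u]][[v]]: the coefficient of u^i v^j in f is f j i. *)
Definition powser2 : Type := powser (powser S).

HB.instance Definition _ := GRing.ComNzRing.on powser2.

Definition ps2C (c : S) : powser2 := psC (psC c).
Definition ps2_u : powser2 := psC psX.
Definition ps2_v : powser2 := psX.

Lemma ps2_coefM (f g : powser2) i j :
  (f * g) j i = \sum_(q < j.+1) \sum_(p < i.+1) f q p * g (j - q)%N (i - p)%N.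
Proof. by rewrite ps_coefM fct_sumE. Qed.

End PowerSeries2.

Section PrincipalIdeal.
Variables (R : comNzRingType) (a : R) (a_nonunit : forall b, b * a <> 1).

(* The properness proof is an argument because idealr requires 1 \notin I. *)
Definition principal of (forall b, b * a <> 1) : {pred R} :=
  fun x => `[< exists b, x = b * a >].

Lemma principal_idealr : idealr_closed (principal a_nonunit).
Proof.
split; first by apply/asboolP; exists 0; rewrite mul0r.
  by apply/asboolP => -[b /esym]; exact: a_nonunit.
move=> c x y /asboolP[p ->] /asboolP[q ->]; apply/asboolP.
by exists (c * p + q); rewrite mulrDl mulrA.
Qed.

HB.instance Definition _ := isIdealr.Build R (principal a_nonunit)
  principal_idealr.

End PrincipalIdeal.

Section Hypersurface.
Variables (S : comNzRingType) (n : set S) (f : S).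
Hypotheses (nloc : local_ring n) (fn2 : ideal_pow n 2 f).

Definition hyp_eqn : powser2 S := ps2C f + ps2_u S * ps2_v S.

Lemma hyp_eqn_nonunit (b : powser2 S) : b * hyp_eqn <> 1.
Proof.
have [_ [[n0 nD nM] n1 _] _] := nloc; have [k [x [y [xn _ fE]]]] := fn2.
have fn : n f.
  by rewrite fE; elim/big_ind: _ => // i _; rewrite mulrC; exact/nM/xn.
move=> /(congr1 (fun g : powser2 S => g 0%N 0%N)) b1; apply: n1.
suff <- : b 0%N 0%N * f = 1 by exact: nM.
rewrite -[RHS]/((1 : powser2 S) 0%N 0%N) -b1 ps2_coefM !big_ord1.
congr (_ * _); rewrite /hyp_eqn -[RHS]/(_ + _) ps2_coefM !big_ord1.
by rewrite mul0r addr0.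
Qed.

Definition hypersurface : Type := {ideal_quot (principal hyp_eqn_nonunit)}.

HB.instance Definition _ := GRing.ComNzRing.on hypersurface.

Definition hyp_pi (g : powser2 S) : hypersurface :=
  \pi_({ideal_quot (principal hyp_eqn_nonunit)}) g.

Lemma hyp_pi_zmod : zmod_morphism hyp_pi.
Proof. exact: (raddfB \pi_({ideal_quot (principal hyp_eqn_nonunit)})). Qed.

Lemma hyp_pi_monoid : monoid_morphism hyp_pi.
Proof.
split; first exact: (rmorph1 \pi_({ideal_quot (principal hyp_eqn_nonunit)})).
exact: (rmorphM \pi_({ideal_quot (principal hyp_eqn_nonunit)})).
Qed.

HB.instance Definition _ :=
  GRing.isZmodMorphism.Build (powser2 S) hypersurface hyp_pi hyp_pi_zmod.
HB.instance Definition _ :=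
  GRing.isMonoidMorphism.Build (powser2 S) hypersurface hyp_pi hyp_pi_monoid.

Lemma hyp_piP g h : hyp_pi g = hyp_pi h <-> exists b, g - h = b * hyp_eqn.
Proof.
have E := Quotient.idealrBE (principal hyp_eqn_nonunit) g h.
split=> [/eqP|] gh; first by apply/asboolP; exact: etrans E gh.
by apply/eqP; apply: etrans (esym E) _; apply/asboolP.
Qed.

Lemma hyp_rel : hyp_pi (ps2C f) + hyp_pi (ps2_u S) * hyp_pi (ps2_v S) = 0.
Proof.
rewrite -rmorphM -rmorphD -(rmorph0 hyp_pi).
by apply/hyp_piP; exists 1; rewrite subr0 mul1r.
Qed.

Definition hyp_u : hypersurface := hyp_pi (ps2_u S).
Definition hyp_v : hypersurface := hyp_pi (ps2_v S).

End Hypersurface.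

(* Main.v *)
From HB Require Import structures.
Require Import Defs.
From mathcomp Require Import all_boot all_order all_algebra.
From mathcomp Require Import perm ring.
From mathcomp Require Import boolp classical_sets functions.

(** Put Q = S[[u,v]], F = f + uv and A = Q/(F), let e = dim S, and let
    psi : A^l -> N be a minimal free cover, so that N = Q^l / Z for a submodule
    Z containing F Q^l.

    The heart of the matter is that multiplication by z on N lifts along psi to
    a linear map h : N -> A^l. The ring Q is regular of dimension e + 2, and
    A has dimension at least e + 1, so N has depth at least e + 1. Hence N
    has projective dimension at most one over Q: the submodule Z is free
    (free_of_depth_quotient). If the rows of B form a basis of Z, then
    D B = F and B D = F for some matrix D. Every derivation d of Q satisfies
    d(F) = d(D) B + D d(B), so X = D d(B) agrees with multiplication by d(F)
    modulo Z, and it maps Z into F Q^l because B X = F d(B). The map that X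
    induces from N to A^l is the required lift (scale_factors_through_free).
    The partial derivatives of F with respect to v and u are u and v on the
    nose, with no integer factor; this is why the characteristic of k does not
    matter.

    Moreover z is a nonzerodivisor on N, because F is congruent to f modulo z
    (scale_torsion_free). The kernel of the composite A^l -> N -> N/zN consists
    of the vectors that psi maps into zN, and it is therefore the direct sum
    of h(N), a copy of N, and of the kernel of psi (split_syzygy). By
    Nakayama's lemma this composite is again a minimal free cover, and the
    kernel of a minimal free cover is unique up to isomorphism
    (minimal_cover_kernel_iso).

    The freeness of Z is proved by induction on the dimension of the regular
    local ring, dividing by an element x of a minimal system of generators of
    the maximal ideal that avoids the associated primes of Q^l / Z. Three
    facts are needed: R / (x) is again regular and R is a domain
    (regular_local_image, regular_local_domain), both from Krull's principal
    ideal theorem; the depth drops by at most one modulo x, whichever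
    regular sequence was given (depth_ge_exchange); and a basis lifts from
    R / (x) to R (free_submod_lift). In dimension one, the relations of a
    minimal system of generators are divisible by the uniformizer, so there
    are none. *)

Set Implicit Arguments.
Unset Strict Implicit.
Unset Printing Implicit Defensive.

Import GRing.Theory.
Local Open Scope ring_scope.
Local Open Scope classical_set_scope.

(** * Submodules and Noetherian modules *)

Lemma scaler_swap (R : comNzRingType) (M : lmodType R) (x y : R) (a : M) :
  x *: (y *: a) = y *: (x *: a).
Proof. by rewrite !scalerA mulrC. Qed.

Section Submodules.
Variables (R : comNzRingType) (M : lmodType R).
Implicit Types (L K : set M) (a b : M) (x y r : R).

Definition submod L :=
  [/\ L 0, forall a b, L a -> L b -> L (a + b) & forall r a, L a -> L (r *: a)].

Lemma submod0 L : submod L -> L 0. Proof. by case. Qed.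
Lemma submodD L a b : submod L -> L a -> L b -> L (a + b).
Proof. by case=> _ + _; apply. Qed.
Lemma submodZ L r a : submod L -> L a -> L (r *: a).
Proof. by case=> _ _; apply. Qed.
Lemma submodN L a : submod L -> L a -> L (- a).
Proof. by move=> sL La; rewrite -scaleN1r; apply: submodZ. Qed.
Lemma submodB L a b : submod L -> L a -> L b -> L (a - b).
Proof. by move=> sL La Lb; apply: submodD => //; apply: submodN. Qed.
Lemma submod_sum L k (F : 'I_k -> M) :
  submod L -> (forall i, L (F i)) -> L (\sum_i F i).
Proof.
by move=> sL LF; elim/big_ind: _ => //; [apply: submod0|move=> *;
  apply: submodD].
Qed.
Lemma submod_trans L a b : submod L -> L (a - b) -> L b -> L a.
Proof. by move=> sL ab Lb; rewrite -(subrK b a); apply: submodD. Qed.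

(** The submodules L + R a and L + x M. Quotients of M are handled throughout
    as submodules of M, so that M / (x, y) M involves no iterated quotient. *)
Definition add_cyclic L a : set M := [set b | exists r, L (b - r *: a)].
Definition add_multiples L x : set M := [set b | exists a, L (b - x *: a)].
Definition colon L a : set R := [set r | L (r *: a)].
Definition nonzerodiv_mod x L := forall a, L (x *: a) -> L a.

Lemma submod_add_cyclic L a : submod L -> submod (add_cyclic L a).
Proof.
move=> sL; split=> [|b c [r br] [s cs]|r b [s bs]].
- by exists 0; rewrite scale0r subr0; apply: submod0.
- by exists (r + s); rewrite scalerDl opprD addrACA; apply: submodD.
- by exists (r * s); rewrite -scalerA -scalerBr; apply: submodZ.
Qed.

Lemma sub_add_cyclic L a : L `<=` add_cyclic L a.
Proof. by move=> b Lb; exists 0; rewrite scale0r subr0. Qed.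

Lemma mem_add_cyclic L a : submod L -> add_cyclic L a a.
Proof. by move=> sL; exists 1; rewrite scale1r subrr; apply: submod0. Qed.

Lemma submod_add_multiples L x : submod L -> submod (add_multiples L x).
Proof.
move=> sL; split=> [|b c [r br] [s cs]|r b [s bs]].
- by exists 0; rewrite scaler0 subr0; apply: submod0.
- by exists (r + s); rewrite scalerDr opprD addrACA; apply: submodD.
- by exists (r *: s); rewrite scalerA mulrC -scalerA -scalerBr; apply: submodZ.
Qed.

Lemma sub_add_multiples L x : L `<=` add_multiples L x.
Proof. by move=> b Lb; exists 0; rewrite scaler0 subr0. Qed.

Lemma mem_add_multiples L x a : submod L -> add_multiples L x (x *: a).
Proof. by move=> sL; exists a; rewrite subrr; apply: submod0. Qed.

Lemma add_multiplesC L x y :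
  add_multiples (add_multiples L x) y = add_multiples (add_multiples L y) x.
Proof.
suff H u v : add_multiples (add_multiples L u) v `<=`
    add_multiples (add_multiples L v) u.
  by apply/seteqP; split; apply: H.
by move=> b [c [d H]]; exists d, c; rewrite addrAC.
Qed.

Lemma ideal_colon L a : submod L -> is_ideal (colon L a).
Proof.
move=> sL; split=> [|r s Lr Ls|r s Ls]; rewrite /colon /=.
- by rewrite scale0r; apply: submod0.
- by rewrite scalerDl; apply: submodD.
- by rewrite -scalerA; apply: submodZ.
Qed.

Lemma submod_lspan k (g : 'I_k -> M) : submod (lspan g).
Proof.
split=> [|_ _ [c ->] [d ->]|r _ [c ->]].
- by exists (fun=> 0); rewrite big1 // => i _; rewrite scale0r.
- by exists (fun i => c i + d i); rewrite -big_split; apply: eq_bigr => i _;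
  rewrite scalerDl.
- by exists (fun i => r * c i); rewrite scaler_sumr; apply: eq_bigr => i _;
  rewrite scalerA.
Qed.

Lemma mem_lspan k (g : 'I_k -> M) i : lspan g (g i).
Proof.
exists (fun j => (j == i)%:R).
rewrite (bigD1 i) //= eqxx scale1r big1 ?addr0 //.
by move=> j /negPf ->; rewrite scale0r.
Qed.

Lemma lspan_sub k (g : 'I_k -> M) L :
  submod L -> (forall i, L (g i)) -> lspan g `<=` L.
Proof.
by move=> sL Lg _ [c ->]; apply: submod_sum => // i; apply: submodZ.
Qed.

(** The form in which finite generation is inherited from a submodule and the
    corresponding quotient. *)
Lemma lspan_cat L k (g : 'I_k -> M) k' (g' : 'I_k' -> M) : submod L ->
  (forall i, L (g i)) -> (forall i, L (g' i)) ->
  (forall a, L a -> exists c c',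
     a = \sum_i c i *: g i + \sum_i c' i *: g' i) ->
  exists k'' (g'' : 'I_k'' -> M), L = lspan g''.
Proof.
move=> sL Lg Lg' LE.
exists (k + k')%N, (fun i : 'I_(k + k') =>
  match fintype.split i with inl j => g j | inr j => g' j end).
apply/seteqP; split=> [a /LE [c [c' ->]]|]; last first.
  by apply: lspan_sub => // i; case: (fintype.split i).
exists (fun i : 'I_(k + k') =>
  match fintype.split i with inl j => c j | inr j => c' j end).
rewrite big_split_ord /=; congr (_ + _); apply: eq_bigr => i _.
  by rewrite (unsplitK (inl i)).
by rewrite (unsplitK (inr i)).
Qed.

Definition noetherian_module :=
  forall L, submod L -> exists k (g : 'I_k -> M), L = lspan g.

Hypothesis noeM : noetherian_module.

(** Dependent choice turns a family without maximal member into an increasing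
    sequence; its union is finitely generated, hence reached at a finite
    stage. *)
Lemma noetherian_module_max (F : set (set M)) :
  (forall L, F L -> submod L) -> F !=set0 ->
  exists2 L, F L & forall K, F K -> L `<=` K -> K `<=` L.
Proof.
move=> Fsub [L0 FL0]; apply: contrapT => nomax.
have next (L : {L | F L}) : exists K : {L | F L},
    sval L `<=` sval K /\ ~ (sval K `<=` sval L).
  apply: contrapT => noK; apply: nomax; exists (sval L); first exact: svalP.
  move=> K FK LK; apply: contrapT => nKL; apply: noK.
  by exists (exist _ K FK).
have [nx nxP] := choice next.
pose C n := sval (iter n nx (exist _ L0 FL0)).
have CS n : C n `<=` C n.+1 by case: (nxP (iter n nx (exist _ L0 FL0))).
have Cle m n : (m <= n)%N -> C m `<=` C n.
  move=> /subnK <-; elim: (n - m)%N => // j IH x /IH; exact: CS.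
have sC n : submod (C n) by apply/Fsub/svalP.
pose U : set M := [set x | exists n, C n x].
have sU : submod U.
  split=> [|a b [i ai] [j bj]|r a [i ai]].
  - by exists 0%N; apply: submod0.
  - by exists (maxn i j); apply: submodD => //;
      [move: ai|move: bj]; apply: Cle; rewrite ?leq_maxl ?leq_maxr.
  - by exists i; apply: submodZ.
have [k [g UE]] := noeM sU.
have gU i : exists n, C n (g i).
  by have : U (g i) by rewrite UE; apply: mem_lspan.
have [n nP] := choice gU.
pose N := \max_i n i.
have UN : U `<=` C N.
  rewrite UE; apply: lspan_sub => // i.
  by move: (nP i); apply: Cle; apply: leq_bigmax.
have [_] := nxP (iter N nx (exist _ L0 FL0)); apply.
by move=> x Cx; apply: UN; exists N.+1.
Qed.

Lemma noetherian_module_ind (P : set M -> Prop) :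
  (forall L, submod L ->
     (forall K, submod K -> L `<=` K -> ~ (K `<=` L) -> P K) -> P L) ->
  forall L, submod L -> P L.
Proof.
move=> step L0 sL0; apply: contrapT => nP.
have [||L [sL nPL] Lmax] := @noetherian_module_max [set L | submod L /\ ~ P L].
- by move=> L [].
- by exists L0.
apply: nPL; apply: step => // K sK LK nKL; apply: contrapT => nPK.
by apply: nKL; apply: Lmax.
Qed.

End Submodules.

Lemma noetherian_module_ring (R : comNzRingType) : noetherian R ->
  noetherian_module R^o.
Proof. by move=> noeR L sL; apply: noeR. Qed.

Section AssociatedPrimes.
Variables (R : comNzRingType) (noeR : noetherian R) (M : lmodType R).
Implicit Types L : set M.

(** Existence of associated primes: an annihilator that is maximal among those
    of the nonzero multiples of a is prime. *)
Lemma prime_colon_multiple L a : submod L -> ~ L a ->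
  exists r, ~ L (r *: a) /\ prime_ideal (colon L (r *: a)).
Proof.
move=> sL La.
have [||I [r [Lra IE]] Imax] := noetherian_module_max
    (noetherian_module_ring noeR)
    (F := [set I : set R^o | exists r, ~ L (r *: a) /\ I = colon L (r *: a)]).
- by move=> _ [r [_ ->]]; have [] := ideal_colon (r *: a) sL.
- by exists (colon L (1 *: a)), 1; rewrite scale1r.
exists r; split=> //; split; first exact: ideal_colon.
  by rewrite /colon /= scale1r.
move=> x y xyC; case: (pselect (L (y *: (r *: a)))) => [|nyC]; [by right|left].
have : colon L ((y * r) *: a) `<=` I.
  apply: Imax; first by exists (y * r); rewrite -scalerA.
  rewrite IE => s Ls; rewrite /colon /= -(scalerA y) (scaler_swap s).
  by apply: submodZ.
rewrite IE => /(_ x) H; apply: H; rewrite /colon /=.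
by rewrite -(scalerA y) (scalerA x).
Qed.

(** Induction along a prime filtration of M / L: each step adjoins an element
    whose annihilator modulo L is prime. It terminates by the ascending chain
    condition. *)
Lemma prime_filtration_ind (P : set M -> Prop) : noetherian_module M ->
  P setT ->
  (forall L a, submod L -> prime_ideal (colon L a) -> P (add_cyclic L a) ->
    P L) ->
  forall L, submod L -> P L.
Proof.
move=> noeM PT step; apply: noetherian_module_ind => // L sL IH.
have [->//|/eqP/setTPn [a La]] := pselect (L = setT).
have [r [Lra pr]] := prime_colon_multiple sL La.
apply: (step _ (r *: a)) => //; apply: IH; first exact: submod_add_cyclic.
  exact: sub_add_cyclic.
by move=> /(_ _ (mem_add_cyclic (r *: a) sL)).
Qed.

End AssociatedPrimes.

(** * Nakayama's lemma and Krull's principal ideal theorem *)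

Section Nakayama.
Variable R : comNzRingType.

(** Modulo I the matrix is diagonal. *)
Lemma det_diag_congr k (w : 'I_k -> R) (I : set R) (C : 'M[R]_k) :
  is_ideal I -> (forall i j, I (C i j)) ->
  I (\det (diag_mx (\row_i w i) - C) - \prod_i w i).
Proof.
move=> [I0 ID IM] IC.
have -> : \prod_i w i = \det (diag_mx (\row_i w i)).
  by rewrite det_diag; apply: eq_bigr => i _; rewrite mxE.
pose eqI (a b : R) := I (a - b).
have eqIR a : eqI a a by rewrite /eqI subrr.
have eqID a b c d : eqI a b -> eqI c d -> eqI (a + c) (b + d).
  by move=> ab cd; rewrite /eqI opprD addrACA; apply: ID.
have eqIM a b c d : eqI a b -> eqI c d -> eqI (a * c) (b * d).
  move=> ab cd; have -> : eqI (a * c) (b * d) = I (c * (a - b) + b * (c - d)).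
    by congr I; ring.
  by apply: ID; apply: IM.
rewrite /determinant; apply: (big_rec2 eqI) => [|s a b _ ab]; first exact: eqIR.
apply: eqID ab; apply: (eqIM _ _ _ _ (eqIR _)).
apply: (big_rec2 eqI) => [|i c d _ cd]; first exact: eqIR.
apply: eqIM cd; rewrite /eqI !mxE addrAC subrr add0r -mulN1r; exact: IM.
Qed.

(** Determinant trick: the adjugate of the matrix of the given relations turns
    them into the relation that multiplies each generator by the determinant.
    The factors w i allow use at a prime without localising. *)
Lemma nakayama_det (M : lmodType R) k (g : 'I_k -> M) (L : set M)
    (w : 'I_k -> R) (I : set R) : submod L -> is_ideal I ->
  (forall i, exists c : 'I_k -> R,
     (forall j, I (c j)) /\ L (w i *: g i - \sum_j c j *: g j)) ->
  exists2 e, I e & forall i, L ((\prod_j w j + e) *: g i).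
Proof.
move=> sL hI H; have [c cP] := choice H.
pose B := diag_mx (\row_i w i) - \matrix_(i, j) c i j.
exists (\det B - \prod_i w i) => [|i].
  by apply: det_diag_congr => // i j; rewrite mxE; case: (cP i).
rewrite addrC subrK.
have BL j : L (\sum_m B j m *: g m).
  have -> : \sum_m B j m *: g m = w j *: g j - \sum_m c j m *: g m.
    rewrite -sumrN (eq_bigr (fun m => (w j *+ (j == m)) *: g m
       + - (c j m *: g m))); last by move=> m _; rewrite !mxE scalerBl.
    rewrite big_split /= (bigD1 j) //= eqxx mulr1n big1 ?addr0 // => m.
    by rewrite eq_sym => /negPf ->; rewrite scale0r.
  by case: (cP j).
have -> : \det B *: g i = \sum_j \adj B i j *: \sum_m B j m *: g m.
  transitivity (\sum_m (\adj B *m B) i m *: g m).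
    rewrite mul_adj_mx (bigD1 i) //= mxE eqxx mulr1n big1 ?addr0 // => m.
    by rewrite mxE eq_sym => /negPf ->; rewrite scale0r.
  under eq_bigr => m _ do rewrite mxE scaler_suml.
  rewrite exchange_big; apply: eq_bigr => j _; rewrite scaler_sumr.
  by apply: eq_bigr => m _; rewrite scalerA.
by apply: submod_sum => // j; apply: submodZ.
Qed.

End Nakayama.

Section Primes.
Variable R : comNzRingType.
Implicit Types (I P : set R) (x y : R).

Lemma ideal_submod I : is_ideal I -> submod (I : set R^o).
Proof. by []. Qed.

Lemma prime_submod P : prime_ideal P -> submod (P : set R^o).
Proof. by case. Qed.

Lemma prime_not1 P : prime_ideal P -> ~ P 1.
Proof. by case. Qed.

Lemma prime_mul P x y : prime_ideal P -> ~ P x -> ~ P y -> ~ P (x * y).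
Proof. by case=> _ _ Pp Px Py /Pp []. Qed.

Lemma prime_prod P k (w : 'I_k -> R) :
  prime_ideal P -> (forall i, ~ P (w i)) -> ~ P (\prod_i w i).
Proof.
move=> pP Pw; elim/big_ind: _ => //; first exact: prime_not1.
by move=> *; apply: prime_mul.
Qed.

Lemma prime_expn P x n : prime_ideal P -> ~ P x -> ~ P (x ^+ n).
Proof.
move=> pP Px; elim: n => [|n IH]; first by rewrite expr0; apply: prime_not1.
by rewrite exprS; apply: prime_mul.
Qed.

Lemma ideal_mulr I x y : is_ideal I -> I x -> I (x * y).
Proof. by case=> _ _ IM Ix; rewrite mulrC; apply: IM. Qed.

Lemma ideal_mull I x y : is_ideal I -> I y -> I (x * y).
Proof. by case=> _ _ IM Ix; apply: IM. Qed.

End Primes.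

Section PrincipalIdealTheorem.
Variables (R : comNzRingType) (noeR : noetherian R).

(** If P is minimal over I, the localisation of R / I at P has finite length,
    so descending chains of ideals become stationary there. The statement
    clears denominators w outside P. The proof inducts along a prime filtration
    of R / I. *)
Lemma descending_chain_stable (I P : set R) (J : nat -> set R^o) :
  is_ideal I -> prime_ideal P ->
  (forall Q, prime_ideal Q -> I `<=` Q -> Q `<=` P -> P `<=` Q) ->
  (forall n, submod (J n)) -> (forall n, J n.+1 `<=` J n) ->
  exists n0, forall n, (n0 <= n)%N -> forall t, J n t ->
    exists w k, [/\ ~ P w, J n.+1 k & I (w * t - k)].
Proof.
move=> hI prP minP sJ JS.
have Jle m n : (m <= n)%N -> J n `<=` J m.
  by move=> /subnK <-; elim: (n - m)%N => // j IH t /JS /IH.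
pose stable (L : set R^o) := I `<=` L ->
  exists n0, forall n, (n0 <= n)%N -> forall t, J n t ->
  exists w k, [/\ ~ P w, J n.+1 k & L (w * t - k)].
suff : stable (I : set R^o) by apply.
apply: (prime_filtration_ind noeR (noetherian_module_ring noeR))
  (ideal_submod hI).
  move=> _; exists 0%N => n _ t _; exists 1, 0; split=> //.
    exact: prime_not1.
  exact: submod0.
move=> L a sL prC IH IL.
have [|n0 IHn] := IH; first by move=> t /IL Lt; apply: sub_add_cyclic.
have IC : I `<=` colon L a.
  move=> t It; rewrite /colon /= -[_ *: _]/(t * a) mulrC.
  exact/(submodZ _ sL)/IL.
(* At P the step from L to L + (a) is trivial unless its prime (L : a), which
   contains I, equals P. *)
have [CP|nCP] := pselect (colon L a `<=` P); last first.
  have [w' Cw' Pw'] : exists2 w, colon L a w & ~ P w.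
    apply: contrapT => H; apply: nCP => t Ct; apply: contrapT => Pt.
    by apply: H; exists t.
  exists n0 => n /IHn IHn' t /IHn' [w [k [Pw Jk [r Lr]]]].
  exists (w' * w), (w' * k).
  split; [exact: prime_mul|exact: (submodZ _ (sJ _))|].
  have -> : w' * w * t - w' * k =
      w' *: (w * t - k - r * a : R^o) + r *: (w' *: a).
    by rewrite /GRing.scale /= !mulrBr !mulrA (mulrC w' r) subrK.
  by apply: (submodD sL); apply: (submodZ _ sL).
have PC := minP _ prC IC CP.
(* Otherwise the step is a copy of the residue field at P, and the images of
   the J n in it are either always everything or eventually zero. *)
pose full n := exists s k, [/\ ~ P s, J n k & L (s * a - k)].
have [aJ|naJ] := pselect (forall n, full n).
  exists n0 => n /IHn IHn' t /IHn' [w [k [Pw Jk [r Lr]]]].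
  have [s [k' [Ps Jk' Lk']]] := aJ n.+1.
  exists (s * w), (s * k + r * k'); split; first exact: prime_mul.
    by apply: (submodD (sJ _)); apply: (submodZ _ (sJ _)).
  have -> : s * w * t - (s * k + r * k') =
      s *: (w * t - k - r * a : R^o) + r *: (s * a - k' : R^o).
    rewrite /GRing.scale /= !mulrBr !mulrA (mulrC s r) addrA subrK.
    by rewrite opprD addrA.
  by apply: (submodD sL); apply: (submodZ _ sL).
have [n1 nfull] : exists n, ~ full n.
  apply: contrapT => H; apply: naJ => n; apply: contrapT => Hn.
  by apply: H; exists n.
exists (maxn n0 n1) => n; rewrite geq_max => /andP[/IHn IHn' n1n] t Jt.
have [w [k [Pw Jk [r Lr]]]] := IHn' _ Jt.
exists w, k; split=> //; apply: (submod_trans sL Lr).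
apply: PC; apply: contrapT => Pr; apply: nfull.
exists r, (w * t - k); split=> //; last first.
  by rewrite -opprB; apply: (submodN sL).
apply: (submodB (sJ _)); first by apply: (submodZ _ (sJ _)); apply: Jle Jt.
by apply: Jle Jk; apply: leqW.
Qed.

(** Krull's principal ideal theorem in the domain R / P0: a prime minimal over
    x has height one, so the intermediate prime P1 can be exchanged for one
    that contains x. Suppose that P2 is minimal over P0 + (x), and take y in P1
    outside P0. The contractions J n of the ideals P0 + (y ^ n) from the
    localisation at P1 stabilise at P2 modulo x, and x is a unit at P1, whence
    J n = J n.+1 for some n by Nakayama; but then y is a unit at P1. *)
Lemma principal_ideal_theorem (P0 P1 P2 : set R) (x : R) :
  prime_ideal P0 -> prime_ideal P1 -> prime_ideal P2 ->
  P0 `<` P1 -> P1 `<` P2 -> P2 x -> ~ P0 x ->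
  exists P, [/\ prime_ideal P, P x, P0 `<` P & P `<` P2].
Proof.
move=> pr0 pr1 pr2 [P01 n10] [P12 n21] P2x P0x; apply: contrapT => noP.
have minP P : prime_ideal P -> P x -> P0 `<=` P -> P `<=` P2 -> P2 `<=` P.
  move=> prP Px P0P PP2; apply: contrapT => n2P; apply: noP; exists P.
  by split=> //; split=> // PP0; apply/P0x/PP0.
have P1x : ~ P1 x by move=> /minP -/(_ pr1 P01 P12).
have [y P1y P0y] : exists2 y, P1 y & ~ P0 y.
  apply: contrapT => H; apply: n10 => t P1t; apply: contrapT => P0t.
  by apply: H; exists t.
have [s0 s1 s2] := And3 (prime_submod pr0) (prime_submod pr1) (prime_submod
  pr2).
pose J n : set R^o :=
  [set t | exists s r, ~ P1 s /\ P0 (s * t - r * y ^+ n)].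
have sJ n : submod (J n).
  split=> [|t t' [s [r [Ps Pr]]] [s' [r' [Ps' Pr']]]|a t [s [r [Ps Pr]]]].
  - exists 1, 0; split; first exact: prime_not1.
    by rewrite mulr0 mul0r subrr; apply: (submod0 s0).
  - exists (s * s'), (s' * r + s * r'); split; first exact: prime_mul.
    have -> : s * s' * (t + t') - (s' * r + s * r') * y ^+ n =
       s' * (s * t - r * y ^+ n) + s * (s' * t' - r' * y ^+ n).
      ring.
    by apply: (submodD s0); apply: (submodZ _ s0).
  - exists s, (a * r); split=> //.
    have -> : s * (a *: t) - a * r * y ^+ n = a *: (s * t - r * y ^+ n : R^o).
      by rewrite /GRing.scale /= mulrBr !mulrA (mulrC a s).
    exact: (submodZ _ s0).
have Jsat n s t : ~ P1 s -> J n (s * t) -> J n t.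
  move=> Ps [s' [r [Ps' Pr]]]; exists (s' * s), r; split;
    last by rewrite -mulrA.
  exact: prime_mul.
have P0J n : P0 `<=` J n.
  move=> t P0t; exists 1, 0; split; first exact: prime_not1.
  by rewrite mul1r mul0r subr0.
have JS n : J n.+1 `<=` J n.
  move=> t [s [r [Ps Pr]]]; exists s, (r * y); split=> //.
  by rewrite -mulrA -exprS.
(* Localised at P2, the J n stabilise modulo x. *)
have [||||n0 /(_ n0 (leqnn _)) stab0] :=
  @descending_chain_stable (add_cyclic (P0 : set R^o) (x : R^o)) P2 J _ pr2.
- exact: submod_add_cyclic s0.
- move=> Q prQ IQ; apply: minP => //; first by apply: IQ; apply: mem_add_cyclic.
  by move=> t P0t; apply: IQ; apply: sub_add_cyclic.
- exact: sJ.
- exact: JS.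
have [k [g JE]] := noeR (I := J n0) (sJ n0).
have gJ i : J n0 (g i) by rewrite JE; apply: mem_lspan.
(* As J n0 is P1-saturated and x lies outside P1, the multiple of x in the
   relation above has its cofactor in J n0: locally J n0 = J n0.+1 + x J n0,
   so Nakayama gives J n0 = J n0.+1. *)
have /choice [w wP] i : exists w, ~ P2 w /\ exists c : 'I_k -> R,
    (forall j, P2 (c j)) /\ J n0.+1 (w *: g i - \sum_j c j *: g j).
  have [w [j [P2w Jj [r Pr]]]] := stab0 _ (gJ i).
  exists w; split=> //.
  have : J n0 r; last rewrite JE => -[c rE].
    apply: (Jsat _ x) => //.
    have -> : x * r = (w * g i - j) - (w * g i - j - r * x).
      by rewrite subKr mulrC.
    apply: (submodB (sJ _)); last exact: P0J.
    apply: (submodB (sJ _)); last exact: JS.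
    exact: (submodZ _ (sJ _)).
  exists (fun j => x * c j); split.
    by move=> i'; apply: ideal_mulr => //; case: pr2.
  have -> : \sum_j (x * c j) *: g j = x *: (r : R^o).
    by rewrite rE scaler_sumr; apply: eq_bigr => i' _; rewrite scalerA.
  have -> : w *: g i - x *: (r : R^o) = (w * g i - j - r * x) + j.
    by rewrite /GRing.scale /= (mulrC x) addrAC subrK.
  by apply: (submodD (sJ _)) => //; apply: P0J.
have hP2 : is_ideal P2 by case: pr2.
have [e P2e' eP] := nakayama_det (sJ n0.+1) hP2 (fun i => (wP i).2).
have P2e : ~ P2 (\prod_j w j + e).
  move=> H; have := prime_prod pr2 (fun i => (wP i).1); apply.
  by rewrite -(addrK e (\prod_j w j)); apply: (submodB s2).
have Jy : J n0 (y ^+ n0).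
  exists 1, 1; split; first exact: prime_not1.
  by rewrite subrr; apply: (submod0 s0).
have : J n0.+1 (y ^+ n0).
  suff : J n0 `<=` J n0.+1 by apply.
  rewrite JE; apply: lspan_sub => // i; apply: (Jsat _ _ _ _ (eP i)).
  by move=> /P12.
(* s y ^ n0 = r y ^ n0.+1 modulo P0 with s outside P1, yet y is in P1. *)
move=> [s [r [P1s]]]; rewrite exprS mulrA -mulrBl => H.
apply: (prime_mul pr0 _ _ H); last exact: prime_expn.
move=> /P01 P1d; apply: P1s; rewrite -(subrK (r * y) s).
by apply: (submodD s1) => //; apply: (submodZ _ s1).
Qed.

End PrincipalIdealTheorem.

(** * Local rings and chains of primes *)

Section LocalRings.
Variable R : comNzRingType.
Implicit Types (m P : set R) (x : R).

(** A Noetherian local ring with maximal ideal m, through the units; this form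
    passes to quotients and to power series without mentioning other maximal
    ideals. *)
Definition is_local m :=
  [/\ noetherian R, is_ideal m, ~ m 1 & forall a, ~ m a -> exists b, b * a = 1].

Lemma is_local_noetherian m : is_local m -> noetherian R. Proof. by case. Qed.
Lemma is_local_ideal m : is_local m -> is_ideal m. Proof. by case. Qed.
Lemma is_local_unit m a : is_local m -> ~ m a -> exists b, b * a = 1.
Proof. by case=> _ _ _; apply. Qed.

Lemma proper_ideal_sub m I : is_local m -> is_ideal I -> ~ I 1 -> I `<=` m.
Proof.
move=> lm hI I1 a Ia; apply: contrapT => /(is_local_unit lm) [b ba].
by apply: I1; rewrite -ba; apply: ideal_mull.
Qed.

Lemma is_local_prime m : is_local m -> prime_ideal m.
Proof.
move=> lm; have [_ hm m1 _] := lm; split=> // x y mxy.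
have [|/(is_local_unit lm) [b bx]] := pselect (m x); [by left|right].
by rewrite -(mul1r y) -bx -mulrA; apply: ideal_mull.
Qed.

Lemma is_local_unit1D m a : is_local m -> m a -> exists b, b * (1 + a) = 1.
Proof.
move=> lm ma; apply: (is_local_unit lm) => m1a; have [_ hm m1 _] := lm;
  apply: m1.
by rewrite -(addrK a 1); apply: (submodB (ideal_submod hm)).
Qed.

Lemma is_local_of_local_ring m : local_ring m -> is_local m.
Proof.
move=> [noeR [hm m1 mmax] muniq]; split=> // a ma; apply: contrapT => nua.
pose F := [set I : set R^o | [/\ is_ideal I, ~ I 1 & I a]].
have [||I [hI I1 Ia] Imax] := noetherian_module_max (noetherian_module_ring
  noeR) (F := F).
- by move=> I [].
- exists [set t | exists b, t = b * a]; split=> //.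
  + split=> [|_ _ [b ->] [c ->]|r _ [b ->]].
    * by exists 0; rewrite mul0r.
    * by exists (b + c); rewrite mulrDl.
    * by exists (r * b); rewrite mulrA.
  + by move=> [b /esym ba]; apply: nua; exists b.
  + by exists 1; rewrite mul1r.
apply: ma; rewrite -(muniq I) //; split=> // K hK K1 IK.
apply/seteqP; split=> //; apply: Imax => //; split=> //; exact: IK.
Qed.

(** Nakayama's lemma for the image of K in M / L. *)
Lemma nakayama m (M : lmodType R) (K L : set M) x : is_local m ->
  (exists k (g : 'I_k -> M), K = lspan g) -> submod L -> m x ->
  (forall a, K a -> exists2 b, K b & L (a - x *: b)) -> K `<=` L.
Proof.
move=> lm [k [g KE]] sL mx KL; have hm := is_local_ideal lm.
have H i : exists c : 'I_k -> R,
    (forall j, m (c j)) /\ L (1 *: g i - \sum_j c j *: g j).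
  have [|b] := KL (g i); first by rewrite KE; apply: mem_lspan.
  rewrite KE => -[c ->]; exists (fun j => x * c j); split=> [j|].
    exact: ideal_mulr.
  by rewrite scale1r; under eq_bigr => j _ do rewrite -scalerA;
    rewrite -scaler_sumr.
have [e me He] := nakayama_det (w := fun=> 1) sL hm H.
rewrite KE; apply: lspan_sub => // i.
have [b be] := @is_local_unit1D m e lm me.
move: (He i); rewrite big1 // => /(submodZ b sL).
by rewrite scalerA be scale1r.
Qed.

(** A chain of primes of length n from P0 up to P; only the end points are
    recorded, so that chains can be modified from the top. *)
Fixpoint chain_between n P0 P : Prop :=
  prime_ideal P /\
  (if n is n'.+1 then exists2 P', P' `<` P & chain_between n' P0 P'
   else P = P0).

Lemma chain_between_prime n P0 P : chain_between n P0 P -> prime_ideal P.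
Proof. by case: n => [|n] []. Qed.

Lemma chain_between_prime0 n P0 P : chain_between n P0 P -> prime_ideal P0.
Proof. by elim: n P => [|n IH] P [] => [? <-|_ [P' _ /IH]]. Qed.

Lemma chain_between_cons n P0 P1 P :
  prime_ideal P0 -> P0 `<` P1 -> chain_between n P1 P ->
    chain_between n.+1 P0 P.
Proof.
move=> pr0 P01; elim: n P => [|n IH] P [prP].
  by move=> PE; rewrite PE in prP *; split=> //; exists P0.
by move=> [P' P'P /IH c]; split=> //; exists P'.
Qed.

Lemma chain_between_top n P0 P m : chain_between n P0 P -> P `<=` m ->
  prime_ideal m ->
  exists P0', chain_between n P0' m.
Proof.
case: n => [|n] [prP]; first by move=> _ _ prm; exists m.
move=> [P' [P'P nPP'] c] Pm prm; exists P0; split=> //; exists P' => //.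
by split; [move=> t /P'P /Pm|move=> mP'; apply: nPP' => t /Pm /mP'].
Qed.

Lemma chain_between_of_prime_chain d (p : 'I_d.+1 -> set R) :
  (forall i, prime_ideal (p i)) ->
  (forall i j : 'I_d.+1, (i < j)%N -> p i `<` p j) ->
  chain_between d (p ord0) (p ord_max).
Proof.
move=> prp ltp; suff H i : (i < d.+1)%N -> chain_between i (p ord0) (p (inord
  i)).
  have := H d (ltnSn d); congr (chain_between _ _ (p _)).
  by apply/val_inj; rewrite /= inordK.
elim: i => [|i IH] id; split=> //; first by congr p; apply/val_inj;
  rewrite /= inordK.
by exists (p (inord i)); [apply: ltp; rewrite !inordK // ltnW|apply: IH;
  apply: ltnW].
Qed.

Lemma prime_chain_of_chain_between n P0 P : chain_between n P0 P ->
  prime_chain R n.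
Proof.
move=> c; suff [q [_ prq ltq]] : exists q : nat -> set R, [/\ q n = P,
    forall i, (i <= n)%N -> prime_ideal (q i) &
    forall i j, (i < j <= n)%N -> q i `<` q j].
  exists (fun i => q i); split=> [i|i j ij]; first by apply: prq; rewrite -ltnS.
  by apply: ltq; rewrite ij -ltnS /=.
elim: n P c => [|n IH] P [prP].
  by move=> _; exists (fun=> P); split=> // i [|j] //; rewrite andbF.
move=> [P' [P'P nPP'] /IH [q [qn prq ltq]]].
exists (fun i => if (i <= n)%N then q i else P); split=> [|i|i j].
- by rewrite ltnn.
- by move=> _; case: leqP => // /prq.
move=> /andP[ij jn]; case: (leqP j n) => [jn'|nj].
  by rewrite (leq_trans (ltnW ij) jn'); apply: ltq; rewrite ij.
have -> : (i <= n)%N by rewrite -ltnS (leq_trans ij).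
have [->|ni] := eqVneq i n; first by rewrite qn.
have ni' : (i < n)%N by rewrite ltn_neqAle ni -ltnS (leq_trans ij).
have [iP' niP'] : q i `<` q n by apply: ltq; rewrite ni' /=.
rewrite -qn in P'P nPP'; split; first by move=> t /iP' /P'P.
by move=> Pi; apply: nPP' => t /Pi /iP'.
Qed.

(** Dimension drops by at most one modulo x. Going down the chain, the
    principal ideal theorem replaces each prime by one containing x; only the
    bottom prime is lost. *)
Lemma chain_between_through n P0 P x : noetherian R ->
  chain_between n.+1 P0 P -> P x ->
  exists P1, [/\ P1 x, P0 `<` P1 & chain_between n P1 P].
Proof.
move=> noeR; elim: n P => [|n IH] P [prP [P' P'P c]] Px.
  by case: c => prP' <-; exists P.
suff [P'' [P''x P''P c'']] : exists P'', [/\ P'' x,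
  P'' `<` P & chain_between n.+1 P0 P''].
  have [P1 [P1x P01 c1]] := IH _ c'' P''x.
  by exists P1; split=> //; split=> //; exists P''.
have [P'x|P'x] := pselect (P' x); first by exists P'.
case: c => prP' [Q QP' c].
have [|] := @principal_ideal_theorem _ noeR Q P' P x (chain_between_prime c)
  prP' prP QP' P'P Px.
  by case: QP' => + _ => /(_ x) QP' /QP'.
move=> P'' [prP'' P''x QP'' P''P]; exists P''; split=> //; split=> //.
by exists Q.
Qed.

(** Only a lower bound on the dimension is required: the upper bound is
    automatic because m has n generators (chain_bound). *)
Definition regular_local m n :=
  [/\ is_local m, exists P0, chain_between n P0 m &
      exists g : 'I_n -> R^o, m = lspan g].

Lemma regular_local_of_regular m : local_ring m -> regular m ->
  exists d, regular_local m d.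
Proof.
move=> /is_local_of_local_ring lm [d [[[p [prp ltp]] _] [g mE]]].
exists d; split=> //; last by exists g.
apply: (chain_between_top (chain_between_of_prime_chain prp ltp));
  last exact: is_local_prime.
by have [hI I1 _] := prp ord_max; apply: proper_ideal_sub.
Qed.

End LocalRings.

(** Here T is R / (x), presented by a surjection q with kernel (x). *)
Section Quotient.
Variables (R T : comNzRingType) (q : {rmorphism R -> T}).
Hypothesis q_surj : forall t, exists a, q a = t.
Implicit Types (P I : set R) (J : set T).

Lemma surj_noetherian : noetherian R -> noetherian T.
Proof.
move=> noeR J hJ; have [J0 JD JM] := hJ.
have [|k [g gE]] := noeR (q @^-1` J).
  split=> [|a b|a b] /=; [by rewrite rmorph0|rewrite rmorphD; exact: JD|].
  by rewrite rmorphM; exact: JM.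
exists k, (fun i => q (g i)); apply/seteqP; split=> [t Jt|].
  have [a qa] := q_surj t; have : (q @^-1` J) a by rewrite /= qa.
  rewrite gE => -[c aE]; exists (fun i => q (c i)).
  by rewrite -qa aE rmorph_sum; apply: eq_bigr => i _; apply: rmorphM.
apply: (lspan_sub (L := (J : set T^o))); first exact: ideal_submod.
by move=> i; have : (q @^-1` J) (g i) by rewrite gE; apply: mem_lspan.
Qed.

Lemma ideal_image I : is_ideal I -> is_ideal (q @` I).
Proof.
move=> [I0 ID IM]; split=> [|_ _ [a Ia <-] [b Ib <-]|t _ [a Ia <-]].
- by exists 0; rewrite ?rmorph0.
- by exists (a + b); rewrite ?rmorphD //; apply: ID.
- by have [r <-] := q_surj t; exists (r * a); rewrite ?rmorphM //; apply: IM.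
Qed.

Variable x : R.
Hypothesis q_ker : forall a, q a = 0 -> exists b, a = b * x.
Hypothesis qx : q x = 0.

Lemma quot_imageE I a : is_ideal I -> I x -> (q @` I) (q a) <-> I a.
Proof.
move=> hI Ix; split=> [[b Ib /esym/eqP]|Ia]; last by exists a.
rewrite -subr_eq0 -rmorphB => /eqP/q_ker [c ac].
rewrite -(subrK b a) ac; apply: (submodD (ideal_submod hI)) => //.
exact: ideal_mull.
Qed.

Lemma is_local_image m : is_local m -> m x -> is_local (q @` m).
Proof.
move=> [noeR hm m1 mu] mx; split; first exact: surj_noetherian.
- exact: ideal_image.
- by rewrite -(rmorph1 q) quot_imageE.
move=> t; have [a <-] := q_surj t; rewrite quot_imageE // => /mu [b ba].
by exists (q b); rewrite -rmorphM ba rmorph1.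
Qed.

Lemma prime_image P : prime_ideal P -> P x -> prime_ideal (q @` P).
Proof.
move=> [hP P1 Pp] Px; split; first exact: ideal_image.
  by rewrite -(rmorph1 q) quot_imageE.
move=> s t; have [a <-] := q_surj s; have [b <-] := q_surj t.
by rewrite -rmorphM !quot_imageE //; apply: Pp.
Qed.

Lemma proper_image I I' : is_ideal I -> is_ideal I' -> I x -> I `<` I' ->
  q @` I `<` q @` I'.
Proof.
move=> hI hI' Ix [II' nI'I]; split; first exact: image_subset.
move=> H; apply: nI'I => a I'a; apply/(quot_imageE _ hI Ix)/H.
by exists a.
Qed.

Lemma chain_between_image n P0 P : chain_between n P0 P -> P0 x ->
  chain_between n (q @` P0) (q @` P).
Proof.
move=> + P0x; elim: n P => [|n IH] P [prP].
  by move=> PE; rewrite PE in prP *; split=> //; apply: prime_image.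
move=> [P' P'P c]; have c' := IH _ c.
have P'x : P' x.
  elim: n P' c {P'P c' IH} => [|n IHn] P' [prP'] => [->//|[Q [QP' _] /IHn]].
  exact: QP'.
split; first by apply: prime_image => //; case: P'P => + _; apply.
exists (q @` P') => //; apply: proper_image => //; last by case: prP.
by case: (chain_between_prime c).
Qed.

Lemma generators_image m n (g : 'I_n -> R) : is_ideal m ->
  (forall a, m a -> exists b (c : 'I_n -> R), a = b * x + \sum_i c i * g i) ->
  (forall i, m (g i)) -> q @` m = lspan (fun i => q (g i) : T^o).
Proof.
move=> hm mg gm; apply/seteqP; split=> [_ [a /mg [b [d ->]] <-]|].
  exists (fun i => q (d i)).
  rewrite rmorphD rmorphM qx mulr0 add0r rmorph_sum.
  by apply: eq_bigr => i _; rewrite rmorphM.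
apply: (lspan_sub (L := (q @` m : set T^o))).
  exact: ideal_submod (ideal_image hm).
by move=> i; exists (g i).
Qed.

(** Dividing a regular local ring by one of a minimal system of generators of
    its maximal ideal keeps it regular: the number of generators drops by one,
    and a chain loses at most one step. *)
Lemma regular_local_image m n (g : 'I_n -> R) : regular_local m n.+1 -> m x ->
  (forall a, m a -> exists b (c : 'I_n -> R), a = b * x + \sum_i c i * g i) ->
  (forall i, m (g i)) -> regular_local (q @` m) n.
Proof.
move=> [lm [P0 c] _] mx mg gm.
have [P1 [P1x _ c1]] := chain_between_through (is_local_noetherian lm) c mx.
split; [exact: is_local_image|by exists (q @` P1); apply: chain_between_image|].
by exists (fun i => q (g i)); apply: generators_image => //;
  apply: is_local_ideal.
Qed.

End Quotient.

Lemma principal_quotient (R : comNzRingType) (x : R) : (forall b, b * x <> 1) ->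
  exists (T : comNzRingType) (q : {rmorphism R -> T}),
    [/\ forall t, exists a, q a = t, forall a, q a = 0 -> exists b, a = b * x &
        q x = 0].
Proof.
move=> nux; pose T : comNzRingType := {ideal_quot (principal nux)}.
pose q : {rmorphism R -> T} := \pi_({ideal_quot (principal nux)})%qT.
have qE a : (q a == 0) = (a \in principal nux).
  have E := Quotient.idealrBE (principal nux) a 0.
  by rewrite subr0 in E; rewrite E -(rmorph0 q).
exists T, q; split.
- by move=> t; exists (repr (t : {ideal_quot (principal nux)})); apply: reprK.
- by move=> a /eqP; rewrite qE => /asboolP.
- by apply/eqP; rewrite qE; apply/asboolP; exists 1; rewrite mul1r.
Qed.

(** * Regular local rings are domains *)

Lemma is_local_nonunit (R : comNzRingType) (m : set R) x :
  is_local m -> m x -> forall b, b * x <> 1.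
Proof. by move=> [_ hm m1 _] mx b bx; apply: m1; rewrite -bx;
  apply: ideal_mull. Qed.

Lemma chain_between_sub (R : comNzRingType) n (P0 P : set R) :
  chain_between n P0 P -> P0 `<=` P.
Proof.
elim: n P => [|n IH] P [prP] => [->//|[P' [P'P _] /IH P0P']].
exact: subset_trans P'P.
Qed.

Lemma lspan_lift (R : comNzRingType) (M : lmodType R) n (g : 'I_n.+1 -> M) i a :
  lspan g a -> exists b (c : 'I_n -> R),
    a = b *: g i + \sum_j c j *: g (lift i j).
Proof.
by move=> [c ->]; exists (c i), (fun j => c (lift i j)); rewrite (bigD1_ord i).
Qed.

(** The dimension is at most the number of generators of m: dividing by one
    generator shortens a chain by at most one. *)
Lemma chain_bound e (R : comNzRingType) (m : set R) (g : 'I_e -> R^o) c P0 :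
  is_local m -> m = lspan g -> chain_between c P0 m -> (c <= e)%N.
Proof.
elim: e R m g c P0 => [|e IH] R m g [//|c] P0 lm mE ch.
  case: ch => _ [P' [_ nmP'] /chain_between_prime [hP' _ _]]; case: nmP'.
  rewrite mE; move=> _ [d ->]; rewrite big_ord0;
    exact: submod0 (ideal_submod hP').
have mg i : m (g i) by rewrite mE; apply: mem_lspan.
have [P1 [P1x _ c1]] := chain_between_through (is_local_noetherian lm) ch (mg
  ord0).
have [T [q [qs qk qx]]] := principal_quotient (is_local_nonunit lm (mg ord0)).
rewrite ltnS; apply: (IH T (q @` m) (fun i => q (g (lift ord0 i)))).
- exact (is_local_image qs qk lm (mg ord0)).
- apply: (generators_image qs qx (is_local_ideal lm)) => // a.
  by rewrite mE; apply: lspan_lift.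
- exact (chain_between_image qs qk c1 P1x).
Qed.

(** Choose a generator x of m outside the bottom prime P0 of a maximal chain.
    By induction R / (x) is a domain, so (x) is prime; it equals the prime P1
    above P0 that contains x, since otherwise R / (x) would have too long a
    chain. Then P0 = x P0, and Nakayama gives P0 = 0. *)
Lemma regular_local_domain n (R : comNzRingType) (m : set R) :
  regular_local m n -> prime_ideal [set (0 : R)].
Proof.
have zero_ideal (T : comNzRingType) : is_ideal [set (0 : T)].
  by split=> //= [_ _ -> ->|a _ ->]; rewrite ?addr0 ?mulr0.
elim: n R m => [|n IH] R m rR; have [lm [P0 ch] [g mE]] := rR.
  split=> // [/eqP|x y xy]; first by rewrite oner_eq0.
  have [mx|/(is_local_unit lm) [b bx]] := pselect (m x).
    by left; move: mx; rewrite mE => -[c ->]; rewrite big_ord0.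
  by right; rewrite /= -(mul1r y) -bx -mulrA xy mulr0.
have mg i : m (g i) by rewrite mE; apply: mem_lspan.
have [i P0g] : exists i, ~ P0 (g i).
  apply: contrapT => H.
  have mP0 : m `<=` P0.
    rewrite mE; apply: (lspan_sub (L := (P0 : set R^o))).
      exact: prime_submod (chain_between_prime0 ch).
    by move=> i; apply: contrapT => Pi; apply: H; exists i.
  case: ch => _ [P' [P'm nmP'] /chain_between_sub P0P']; apply: nmP'.
  exact: subset_trans P0P'.
have [P1 [P1x [P01 nP10] c1]] := chain_between_through (is_local_noetherian
  lm) ch (mg i).
have [T [q [qs qk qx]]] := principal_quotient (is_local_nonunit lm (mg i)).
have mlift a : m a -> exists b (c : 'I_n -> R),
  a = b * g i + \sum_j c j * g (lift i j).
  by rewrite mE; apply: lspan_lift.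
have rT := regular_local_image qs qk qx rR (mg i) mlift (fun j => mg _).
have prT := IH _ _ rT.
have hP1 : is_ideal P1 by case: (chain_between_prime0 c1).
(* If P1 were not (x), its image and 0 would extend a chain of length n. *)
have P1E a : P1 a -> exists b, a = b * g i.
  move=> P1a; apply: (qk a); apply: contrapT => qa.
  have c2 : chain_between n.+1 [set 0] (q @` m).
    apply: (chain_between_cons prT _ (chain_between_image qs qk c1 P1x)); split.
      by move=> _ ->; exists 0; rewrite ?rmorph0 //; case: hP1.
    by move=> /(_ (q a)) H; apply/qa/H; exists a.
  have [lT _ [g' mE']] := rT.
  by have := chain_bound lT mE' c2; rewrite ltnn.
have pr0 := chain_between_prime0 ch.
suff P0E : P0 `<=` [set 0].
  have <- : P0 = [set 0].
    by apply/seteqP; split=> // _ ->; exact: submod0 (prime_submod pr0).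
  exact: pr0.
apply: (nakayama (K := (P0 : set R^o)) lm
   (noetherian_module_ring (is_local_noetherian lm) (prime_submod pr0))
     (ideal_submod (zero_ideal R)) (mg i)).
move=> a P0a; have [b ab] := P1E _ (P01 _ P0a).
exists b; last by rewrite ab /= [g i *: _]mulrC subrr.
by have [_ _ /(_ b (g i))] := pr0; rewrite -ab => /(_ P0a) [].
Qed.

(** * Power series over regular local rings *)

Section PowerSeries.
Variable R : comNzRingType.
Implicit Types (f g h : powser R).

Lemma ps_coefCM c f n : (psC c * f) n = c * f n.
Proof.
rewrite ps_coefM big_ord_recl /= subn0 big1 ?addr0 // => i _.
by rewrite /psC /= mul0r.
Qed.

Lemma ps_coefXM f n : (psX * f) n = if n is n'.+1 then f n' else 0.
Proof.
rewrite ps_coefM big_ord_recl /= /psX /= mul0r add0r.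
case: n => [|n]; first by rewrite big_ord0.
rewrite big_ord_recl /= mul1r subSS subn0 big1 ?addr0 // => i _.
by rewrite mul0r.
Qed.

Lemma ps_coef0M f g : (f * g) 0%N = f 0%N * g 0%N.
Proof. by rewrite ps_coefM big_ord1. Qed.

Lemma ps_coef_sum k (F : 'I_k -> powser R) n : (\sum_i F i) n = \sum_i F i n.
Proof. exact: (big_morph (fun f : powser R => f n)). Qed.

Lemma ps_coefB f g n : (f - g) n = f n - g n.
Proof. by []. Qed.

Lemma psX_divides f : f 0%N = 0 -> exists g, f = psX * g.
Proof.
move=> f0; exists (fun n => f n.+1); apply/funext => -[|n];
  rewrite ps_coefXM //.
Qed.

Lemma psCMM c d : psC (c * d) = psC c * psC d :> powser R.
Proof. by apply/funext => -[|n]; rewrite ps_coefCM //= mulr0. Qed.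

Lemma psC_sum k (F : 'I_k -> R) : psC (\sum_i F i) = \sum_i psC (F i) :>
  powser R.
Proof.
apply/funext => n; rewrite ps_coef_sum /psC; case: n => [|n] //=.
by rewrite big1.
Qed.

(** Successive approximation: if every f in P is a combination of the g i with
    constant coefficients up to X times another member of P, then the constants
    obtained at the successive stages are the coefficients of series h i. *)
Lemma ps_approx (P : powser R -> Prop) k (g : 'I_k -> powser R) :
  (forall f, P f -> exists (c : 'I_k -> R) f', P f' /\
     f = \sum_i psC (c i) * g i + psX * f') ->
  forall f, P f -> exists h : 'I_k -> powser R, f = \sum_i h i * g i.
Proof.
move=> step f Pf.
have next (F : {f | P f}) : exists D : ('I_k -> R) * {f | P f},
    sval F = \sum_i psC (D.1 i) * g i + psX * sval D.2.
  by have [c [f' [Pf' fE]]] := step _ (svalP F); exists (c, exist _ f' Pf').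
have [nx nxP] := choice next.
pose F n := iter n (fun F => (nx F).2) (exist _ f Pf).
(* The coefficients found from stage m on, and below the error D m they leave;
   it is divisible by every power of X. *)
pose h m i : powser R := fun n => (nx (F (n + m)%N)).1 i.
exists (h 0%N); apply/subr0_eq.
have hE m i : h m i = psC ((nx (F m)).1 i) + psX * h m.+1 i.
  apply/funext => -[|n]; rewrite ps_coefD ps_coefXM ?addr0 //.
  by rewrite /= /psC /= add0r /h addnS addSn.
pose D m := sval (F m) - \sum_i h m i * g i.
have DE m : D m = psX * D m.+1.
  have -> : D m = sval (F m) - \sum_i (psC ((nx (F m)).1 i) * g i + psX * (h
    m.+1 i * g i)).
    by congr (_ - _); apply: eq_bigr => i _; rewrite hE mulrDl mulrA.
  rewrite big_split -mulr_sumr {1}nxP opprD addrACA subrr add0r -mulrBr.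
  by [].
suff D0 n m : D m n = 0 by apply/funext => n; exact (D0 n 0%N).
by elim: n m => [|n IH] m; rewrite DE ps_coefXM.
Qed.

(** Hilbert's basis theorem for power series. With J n the ideal (I : X ^ n)
    and C n the constant coefficients of its members, C n is stationary from
    some N on, and then lifts of generators of C N generate J N by successive
    approximation. Downward, J n is generated by lifts of generators of C n
    together with X J n.+1; finally I is J 0. *)
Lemma powser_noetherian : noetherian R -> noetherian (powser R).
Proof.
move=> noeR I hI; have sI := ideal_submod hI.
pose J n : set (powser R)^o := [set f | I (psX ^+ n * f)].
have sJ n : submod (J n).
  split=> [|f g|f g] /=; rewrite /J /=.
  - by rewrite mulr0; apply: (submod0 sI).
  - by rewrite mulrDr; apply: (submodD sI).
  - by rewrite [f *: g]mulrC mulrA => If; apply: ideal_mulr.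
have JX n f : J n (psX * f) <-> J n.+1 f by rewrite /J /= mulrA -exprSr.
have JS n : J n `<=` J n.+1.
  by move=> f Jf; apply/JX; apply: (submodZ _ (sJ n)).
have Jle m n : (m <= n)%N -> J m `<=` J n.
  by move=> /subnK <-; elim: (n - m)%N => // j IH t /IH /JS.
pose C n : set R^o := [set c | exists2 f, J n f & f 0%N = c].
have sC n : submod (C n).
  split=> [|_ _ [f Jf <-] [g Jg <-]|a _ [f Jf <-]].
  - by exists 0 => //; apply: submod0.
  - by exists (f + g) => //; apply: submodD.
  - by exists (psC a * f); [apply: (submodZ _ (sJ n))|rewrite ps_coef0M].
have CS n : C n `<=` C n.+1 by move=> _ [f Jf <-]; exists f => //; apply: JS.
have Cle m n : (m <= n)%N -> C m `<=` C n.
  by move=> mn _ [f Jf <-]; exists f => //; apply: Jle Jf.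
have [||_ [N _ <-] Nmax] := noetherian_module_max (noetherian_module_ring
  noeR) (F := range C).
- by move=> _ [n _ <-].
- by exists (C 0%N), 0%N.
have lift_gens n : exists k (g : 'I_k -> powser R), (forall i, J n (g i)) /\
    forall n' f, (n <= n')%N -> J n' f -> C n (f 0%N) ->
    exists (c : 'I_k -> R) f',
      J n'.+1 f' /\ f = \sum_i psC (c i) * g i + psX * f'.
  have [k [c cE]] := noeR _ (sC n).
  have H i : exists f, J n f /\ f 0%N = c i.
    have [f Jf f0] : C n (c i) by rewrite cE; apply: mem_lspan.
    by exists f.
  have [g gP] := choice H; exists k, g; split=> [i|]; first by case: (gP i).
  move=> n' f nn' Jf; rewrite cE => -[a f0]; exists a.
  have [|f' f'E] := @psX_divides (f - \sum_i psC (a i) * g i).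
    rewrite ps_coefB ps_coef_sum f0; apply/eqP; rewrite subr_eq0; apply/eqP.
    by apply: eq_bigr => i _; rewrite ps_coef0M; have [_ ->] := gP i.
  exists f'; split; last by rewrite -f'E addrC subrK.
  apply/JX; rewrite -f'E; apply: (submodB (sJ _)) => //.
  apply: (submod_sum (sJ _)) => i; apply: (submodZ _ (sJ _)).
  by apply: (Jle _ _ nn'); case: (gP i).
have fgN : exists k (g : 'I_k -> (powser R)^o), J N = lspan g.
  have [k [g [Jg gP]]] := lift_gens N; exists k, g.
  apply/seteqP; split=> [f JNf|]; last exact: lspan_sub.
  (* Constant coefficients of members of J n' lie in C n' = C N, so the
     lifted generators absorb them forever. *)
  apply: (@ps_approx (fun f => exists2 n', (N <= n')%N & J n' f)); last first.
    by exists N.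
  move=> {JNf}f [n' Nn' Jf].
  have CNf : C N (f 0%N).
    by apply: (Nmax (C n')); [exists n'|apply: Cle|exists f].
  have [c [f' [Jf' fE]]] := gP n' f Nn' Jf CNf.
  by exists c, f'; split=> //; exists n'.+1; first exact: leqW.
have fgS n : (exists k (g : 'I_k -> (powser R)^o), J n.+1 = lspan g) ->
    exists k (g : 'I_k -> (powser R)^o), J n = lspan g.
  move=> [k' [g' g'E]]; have [k [g [Jg gP]]] := lift_gens n.
  apply: (@lspan_cat _ (powser R)^o (J n) k g k' (fun i => psX * g' i)) => //.
    by move=> i; apply/JX; rewrite g'E; apply: mem_lspan.
  move=> f Jf; have [|c [f' []]] := gP n f (leqnn n) Jf; first by exists f.
  rewrite g'E => -[c' f'E] fE.
  exists (fun i => psC (c i)), c'; rewrite [LHS]fE f'E mulr_sumr.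
  by congr (_ + _); apply: eq_bigr => i _; rewrite [RHS]mulrCA.
have -> : I = J 0%N by apply/seteqP; split=> f; rewrite /J /= expr0 mul1r.
elim: N fgN {lift_gens Nmax} => // n IH /fgS; exact: IH.
Qed.

Definition const_coef_in (m : set R) : set (powser R) := [set f | m (f 0%N)].

Lemma ps_is_local m : is_local m -> is_local (const_coef_in m).
Proof.
move=> [noeR [m0 mD mM] m1 mu]; split; first exact: powser_noetherian.
- split=> [|f g|f g]; rewrite /const_coef_in /=; [exact: m0|exact: mD|].
  by rewrite ps_coef0M; apply: mM.
- exact: m1.
move=> f /mu [b bf].
have [|//|h hE] := @ps_approx (fun=> True) 1 (fun=> f) _ 1.
  move=> g _; exists (fun=> g 0%N * b).
  have [|g' g'E] := @psX_divides (g - psC (g 0%N * b) * f).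
    by rewrite ps_coefB ps_coef0M /psC /= -mulrA bf mulr1 subrr.
  by exists g'; split=> //; rewrite big_ord1 -g'E addrC subrK.
by exists (h ord0); rewrite hE big_ord1.
Qed.

Lemma const_coef_in_prime P : prime_ideal P -> prime_ideal (const_coef_in P).
Proof.
move=> [[P0 PD PM] P1 Pp]; split=> //.
  by split=> [|f g|f g]; rewrite /const_coef_in /=;
    [exact: P0|exact: PD|rewrite ps_coef0M; apply: PM].
by move=> f g; rewrite /const_coef_in /= ps_coef0M; apply: Pp.
Qed.

(** P[[X]] is prime: the product of the first coefficients outside P is, modulo
    P, a coefficient of the product. *)
Lemma coefs_in_prime P : prime_ideal P -> prime_ideal [set f : powser R |
  forall n, P (f n)].
Proof.
move=> prP; have [hP P1 Pp] := prP; have [P0 PD PM] := hP; split.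
- split=> [n|f g Pf Pg n|f g Pg n] /=; [exact: P0|exact: PD|].
  by rewrite ps_coefM; apply: (submod_sum (ideal_submod hP)) => i; apply: PM.
- by move=> /(_ 0%N).
move=> f g Pfg; apply: contrapT => /not_orP[/existsNP[i0 Pi0] /existsNP[j0
  Pj0]].
have [i /asboolP Pi imin] := ex_minnP (ex_intro (fun i =>
  `[< ~ P (f i) >]) i0 (asboolT Pi0)).
have [j /asboolP Pj jmin] := ex_minnP (ex_intro (fun j =>
  `[< ~ P (g j) >]) j0 (asboolT Pj0)).
have fi k : (k < i)%N -> P (f k).
  by move=> ki; apply: contrapT => /asboolP /imin; rewrite leqNgt ki.
have gj k : (k < j)%N -> P (g k).
  by move=> kj; apply: contrapT => /asboolP /jmin; rewrite leqNgt kj.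
apply: (prime_mul prP Pi Pj).
have := Pfg (i + j)%N; rewrite ps_coefM.
have ii : (i < (i + j).+1)%N by rewrite ltnS leq_addr.
rewrite (bigD1 (Ordinal ii)) //= addKn => Ps.
rewrite -[_ * _](addrK (\sum_(k < (i + j).+1 | k != Ordinal ii) f k * g (i +
  j - k)%N)).
apply: (submodB (ideal_submod hP)) => //.
elim/big_ind: _ => //= k ki.
have [ki'|ik] := ltnP k i; first by apply: ideal_mulr => //; apply: fi.
apply: PM; apply: gj.
have {}ki : (i < k)%N by rewrite ltn_neqAle ik andbT eq_sym;
  apply: contra ki => /eqP ki; apply/eqP/val_inj.
have kij : (k <= i + j)%N by rewrite -ltnS.
by rewrite ltn_subLR // ltn_add2r.
Qed.

Lemma const_coef_in_chain n P0 P : chain_between n P0 P ->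
  chain_between n (const_coef_in P0) (const_coef_in P).
Proof.
elim: n P => [|n IH] P [prP].
  by move=> PE; rewrite PE in prP *; split=> //; apply: const_coef_in_prime.
move=> [P' [P'P nPP'] /IH c]; split; first exact: const_coef_in_prime.
exists (const_coef_in P') => //; split=> [f|H]; first exact: P'P.
by apply: nPP' => a Pa; apply: (H (psC a)).
Qed.

(** A chain of primes P of R yields the primes (P, X), and P0[[X]] can be added
    below them; the generators gain X. *)
Lemma ps_regular_local m n : regular_local m n ->
  regular_local (const_coef_in m) n.+1.
Proof.
move=> [lm [P0 c] [g mE]]; split; first exact: ps_is_local.
  have pr0 := chain_between_prime0 c.
  exists [set f : powser R | forall n, P0 (f n)].
  apply: (chain_between_cons (coefs_in_prime pr0) _ (const_coef_in_chain c));
    split; first by move=> f; apply.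
  move=> H; have /(_ 1%N) := H psX (submod0 (prime_submod pr0)).
  exact: prime_not1 pr0.
exists (fun i => if unlift ord0 i is Some j then psC (g j) else psX).
apply/seteqP; split=> [f|].
  rewrite /const_coef_in /= mE => -[c' f0].
  have [|f' f'E] := @psX_divides (f - psC (f 0%N)).
    by rewrite ps_coefB /psC /= subrr.
  exists (fun i => if unlift ord0 i is Some j then psC (c' j) else f').
  rewrite big_ord_recl unlift_none -[f' *: _]/(f' * psX) mulrC -f'E.
  rewrite f0 psC_sum; under [X in _ + X]eq_bigr => i _ do rewrite liftK.
  rewrite -[LHS](subrK (psC (f 0%N))) f0 psC_sum; congr (_ + _).
  by apply: eq_bigr => i _; rewrite psCMM.
have lm' := ps_is_local lm.
apply: (lspan_sub (L := (const_coef_in m : set (powser R)^o)));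
  first exact: ideal_submod (is_local_ideal lm').
move=> i; case: (unliftP ord0 i) => [j|] _; rewrite /const_coef_in /=.
  by rewrite mE; apply: mem_lspan.
by case: (is_local_ideal lm).
Qed.

End PowerSeries.

(** * Prime avoidance and depth *)

(** Induction on l, separating the first coordinate from the others. *)
Lemma noetherian_module_rV (R : comNzRingType) l : noetherian R ->
  noetherian_module 'rV[R]_l.
Proof.
move=> noeR; elim: l => [|l IH] L sL.
  exists 0%N, (fun=> 0); apply/seteqP; split=> [a _|_ [c ->]].
    by exists (fun=> 0); rewrite big_ord0 thinmx0.
  by rewrite big_ord0; apply: submod0.
pose I : set R^o := [set c | exists2 a, L a & a 0 ord0 = c].
have sI : submod I.
  split=> [|_ _ [f Jf <-] [g Jg <-]|a _ [f Jf <-]].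
  - by exists 0; rewrite ?mxE //; apply: submod0.
  - by exists (f + g); rewrite ?mxE //; apply: submodD.
  - by exists (a *: f); rewrite ?mxE //; apply: submodZ.
have [k [c cE]] := noeR _ sI.
have H i : exists f, L f /\ f 0 ord0 = c i.
  have [f Jf f0] : I (c i) by rewrite cE; apply: mem_lspan.
  by exists f.
have [g gP] := choice H.
pose emb : 'rV[R]_l -> 'rV[R]_l.+1 := fun b => row_mx (0 : 'rV_1) b.
have embD b b' : emb (b + b') = emb b + emb b'.
  by rewrite /emb (add_row_mx (0 : 'rV_1)) addr0.
have embZ r b : emb (r *: b) = r *: emb b.
  by rewrite /emb (scale_row_mx r (0 : 'rV_1)) scaler0.
have emb0 : emb 0 = 0 by rewrite -(scale0r 0) embZ scale0r.
have [|k' [g' g'E]] := IH [set b | L (emb b)].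
  split=> [|b b'|r b] /=; first by rewrite emb0; apply: submod0.
    by rewrite embD; apply: submodD.
  by rewrite embZ; apply: submodZ.
apply: (lspan_cat (g := g) (g' := fun i => emb (g' i)) sL) => [i|i|a La].
- by case: (gP i).
- by have : lspan g' (g' i); [apply: mem_lspan|rewrite -g'E].
have : I (a 0 ord0) by exists a.
rewrite cE => -[d a0].
pose a' := a - \sum_i d i *: g i.
have La' : L a'.
  apply: (submodB sL) => //; apply: submod_sum => // i; apply: submodZ => //.
  by case: (gP i).
have a'E : a' = emb (rsubmx (a' : 'rV_(1 + l))).
  suff l0 : lsubmx (a' : 'rV_(1 + l)) = 0 by rewrite /emb -l0 hsubmxK.
  apply/rowP => i; rewrite ord1 !mxE (_ : lshift l 0 = ord0);
    last exact/val_inj.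
  rewrite a0 summxE; apply/eqP; rewrite subr_eq0; apply/eqP/eq_bigr => j _.
  by rewrite mxE; have [_ ->] := gP j.
have : [set b | L (emb b)] (rsubmx (a' : 'rV_(1 + l))) by rewrite /= -a'E.
rewrite g'E => -[d' d'E]; exists d, d'.
rewrite -[LHS](subrK (\sum_i d i *: g i)) addrC -/a' a'E d'E; congr (_ + _).
rewrite (big_morph emb embD emb0); apply: eq_bigr => i _; exact: embZ.
Qed.

Section Avoidance.
Variable R : comNzRingType.

Lemma In_filter (T : Type) (p : pred T) x (s : seq T) :
  List.In x [seq y <- s | p y] <-> List.In x s /\ p x.
Proof.
elim: s => [|y s IH] /=; first by split=> [|[]].
case py : (p y) => /=; rewrite IH; split.
- by move=> [<-|[]]; [split; [left|]|split; [right|]].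
- by move=> [[|]]; [left|right].
- by move=> [? ?]; split; [right|].
- by move=> [[<-|]]; rewrite ?py.
Qed.

(** Prime avoidance in the coset x + J. One prime P is treated last, and the
    other primes only matter when they are not contained in P; an element of J
    and of all of these outside P then corrects the choice made for them. *)
Lemma coset_prime_avoidance (ps : seq (set R)) (J : set R) (x : R) : is_ideal
  J ->
  (forall P, List.In P ps -> prime_ideal P) ->
  (forall P, List.In P ps -> P x -> ~ (J `<=` P)) ->
  exists2 j, J j & forall P, List.In P ps -> ~ P (x + j).
Proof.
move=> hJ; have sJ := ideal_submod hJ.
move: {2}(size ps) (leqnn (size ps)) => n; elim: n ps => [|n IH] [|P ps] //=.
- by exists 0; [apply: submod0 sJ|].
- by exists 0; [apply: submod0 sJ|].
rewrite ltnS => sz prps xps.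
pose ps' := [seq Q <- ps | ~~ `[< Q `<=` P >]].
have psP Q : List.In Q ps' -> List.In Q ps /\ ~ (Q `<=` P).
  by move=> /In_filter [? /asboolPn].
have [|||j Jj avj] := IH ps'.
- by apply: leq_trans sz; rewrite size_filter count_size.
- by move=> Q /psP [? _]; apply: prps; right.
- by move=> Q /psP [? _]; apply: xps; right.
have prP : prime_ideal P by apply: prps; left.
have sP := prime_submod prP.
suff [j' Jj' [avP avj']] : exists2 j', J j' & ~ P (x + j') /\ forall Q,
  List.In Q ps' -> ~ Q (x + j').
  exists j' => // Q [<-//|Qps].
  have [QP|QP] := pselect (Q `<=` P); first by move/QP.
  by apply: avj'; apply/In_filter; split=> //; apply/asboolPn.
have [Pxj|Pxj] := pselect (P (x + j)); last by exists j.
have [t [Jt Pt tps]] : exists t, [/\ J t, ~ P t & forall Q, List.In Q ps' ->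
  Q t].
  have [j0 Jj0 Pj0] : exists2 j0, J j0 & ~ P j0.
    apply: contrapT => H; have JP : J `<=` P.
      by move=> t Jt; apply: contrapT => Pt; apply: H; exists t.
    apply: (xps P (or_introl erefl) _ JP); rewrite -(addrK j x).
    by apply: (submodB sP) => //; apply: JP.
  have : forall Q, List.In Q ps' -> is_ideal Q /\ ~ (Q `<=` P).
    by move=> Q /psP [Qps nQP]; split=> //; case: (prps Q (or_intror Qps)).
  elim: (ps') => [|Q s IHs] Hs; first by exists j0.
  have [|t [Jt Pt ts]] := IHs; first by move=> Q' Q's; apply: Hs; right.
  have [hQ nQP] := Hs Q (or_introl erefl).
  have [u Qu Pu] : exists2 u, Q u & ~ P u.
    apply: contrapT => H; apply: nQP => u Qu; apply: contrapT => Pu.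
    by apply: H; exists u.
  exists (u * t); split; [exact: ideal_mull|exact: prime_mul|].
  move=> Q' [<-|Q's]; first exact: ideal_mulr.
  by apply: ideal_mull; [case: (Hs Q' (or_intror Q's))|apply: ts].
exists (j + t); first exact: (submodD sJ).
split=> [H|Q Qs H]; [apply: Pt|apply: (avj Q Qs)].
  rewrite -(addrK (x + j) t); apply: (submodB sP) => //.
  by rewrite addrC -addrA.
rewrite -(addrK t (x + j)); apply: (submodB (prime_submod (prps Q _))).
- by right; case: (psP _ Qs).
- by rewrite -addrA.
- exact: tps.
Qed.

Variables (noeR : noetherian R) (M : lmodType R) (noeM : noetherian_module M).
Implicit Types L : set M.

(** M / L has finitely many associated primes: along a prime filtration, an
    associated prime of L is the prime of the first step or is associated to
    the next submodule. *)
Lemma finite_assoc L : submod L -> exists ps : seq (set R),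
  (forall P, List.In P ps -> prime_ideal P) /\
  forall b, ~ L b -> prime_ideal (colon L b) -> List.In (colon L b) ps.
Proof.
apply: (prime_filtration_ind noeR (P := fun L => exists ps : seq (set R),
  (forall P, List.In P ps -> prime_ideal P) /\
  forall b, ~ L b -> prime_ideal (colon L b) -> List.In (colon L b) ps)) => //.
  by exists [::]; split=> // b /(_ I).
move=> {}L a sL pra [ps [prps assps]]; exists (colon L a :: ps); split.
  by move=> P [<-|/prps].
move=> b Lb prb.
have [[r [Lrb [t Lt]]]|nr] := pselect (exists r,
  ~ L (r *: b) /\ add_cyclic L a (r *: b)).
  left; have pr_r : ~ colon L b r by [].
  have pr_t : ~ colon L a t by move=> H; apply: Lrb;
    apply: (submod_trans sL Lt).
  have E s : L (s *: (r *: b)) <-> L (s *: (t *: a)).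
    have Ls : L (s *: (r *: b) - s *: (t *: a)).
      by rewrite -scalerBr; apply: submodZ.
    split=> H; last exact: (submod_trans sL Ls).
    by rewrite -(subKr (s *: (r *: b)) (s *: (t *: a))); apply: submodB.
  apply/seteqP; split=> s Cs; apply: contrapT => nCs.
    apply: (prime_mul prb nCs pr_r); rewrite /colon /= -scalerA; apply/E.
    by rewrite scaler_swap; apply: submodZ.
  apply: (prime_mul pra nCs pr_t); rewrite /colon /= -scalerA; apply/E.
  by rewrite scaler_swap; apply: submodZ.
right; have adjE r : add_cyclic L a (r *: b) -> L (r *: b).
  by move=> H; apply: contrapT => H'; apply: nr; exists r.
have CE : colon L b = colon (add_cyclic L a) b.
  by apply/seteqP; split=> r; [apply: sub_add_cyclic|apply: adjE].
rewrite CE in prb *; apply: assps => // H; apply: Lb.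
by rewrite -(scale1r b); apply: adjE; rewrite scale1r.
Qed.

Variable m : set R.
Hypothesis lm : is_local m.

(** No nonzero element of M / L is killed by m, that is, M / L has positive
    depth. *)
Definition socle_trivial L := forall a, (forall s, m s -> L (s *: a)) -> L a.

(** The primes in question are the associated ones, and m is not among them. *)
Lemma nonzerodiv_mod_primes L : submod L -> socle_trivial L ->
  exists ps : seq (set R),
  (forall P, List.In P ps -> prime_ideal P /\ ~ (m `<=` P)) /\
  forall x, (forall P, List.In P ps -> ~ P x) -> nonzerodiv_mod x L.
Proof.
move=> sL socL; have [ps [prps assps]] := finite_assoc sL.
exists [seq P <- ps | ~~ `[< m `<=` P >]]; split.
  by move=> P /In_filter [/prps prP /asboolPn].
move=> x avx a Lxa; apply: contrapT => La.
have [r [Lra pr]] := prime_colon_multiple noeR sL La.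
apply: (avx (colon L (r *: a))).
  apply/In_filter; split; first exact: assps.
  by apply/asboolPn => mC; apply: Lra; apply: socL => s /mC.
by rewrite /colon /= scaler_swap; apply: submodZ.
Qed.

Lemma nonzerodiv_mod_socle y L : m y -> nonzerodiv_mod y L -> socle_trivial L.
Proof. by move=> my nzy a /(_ y my) /nzy. Qed.

(** For x in m, the socles of M / (L + x M) and M / (L + y M) are isomorphic,
    being both Ext^1(R / m, M / L): if y a = x b modulo L, then a corresponds
    to b. *)
Lemma socle_trivial_swap x y L : submod L -> m y -> nonzerodiv_mod x L ->
  nonzerodiv_mod y L ->
  socle_trivial (add_multiples L y) -> socle_trivial (add_multiples L x).
Proof.
move=> sL my nx ny soc a ax.
have [b Lb] := ax _ my.
have [b' Lb'] : add_multiples L y b.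
  apply: soc => s ms; have [c Lc] := ax _ ms; exists c; apply: nx.
  have -> : x *: (s *: b - y *: c) =
     y *: (s *: a - x *: c) - s *: (y *: a - x *: b).
    rewrite !scalerBr !scalerA (mulrC y s) (mulrC y x) (mulrC s x) opprB.
    by rewrite [RHS]addrC addrA subrK.
  by apply: (submodB sL); apply: submodZ.
exists b'; apply: ny.
have -> : y *: (a - x *: b') = (y *: a - x *: b) + x *: (b - y *: b').
  by rewrite !scalerBr addrA subrK scaler_swap.
by apply: (submodD sL) => //; apply: submodZ.
Qed.

(** The module M / L has a regular sequence of length n in m. It may be zero,
    in which case it has depth at least n for every n. *)
Fixpoint depth_ge n L :=
  if n is n'.+1 then
    exists y, [/\ m y, nonzerodiv_mod y L & depth_ge n' (add_multiples L y)]
  else True.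

(** Regular sequences of length two can be permuted. That z stays a
    nonzerodivisor on M / L is Nakayama's lemma for its kernel K, which
    satisfies K = L + y K. *)
Lemma nonzerodiv_mod_permute y z L : submod L -> m y -> nonzerodiv_mod y L ->
  nonzerodiv_mod z (add_multiples L y) ->
  nonzerodiv_mod z L /\ nonzerodiv_mod y (add_multiples L z).
Proof.
move=> sL my ny nz; split; last first.
  move=> a [b Lb].
  have [|b' Lb'] := nz b; first by exists a; rewrite -opprB; apply: submodN.
  exists b'; apply: ny.
  have -> : y *: (a - z *: b') = (y *: a - z *: b) + z *: (b - y *: b').
    by rewrite !scalerBr addrA subrK scaler_swap.
  by apply: (submodD sL) => //; apply: submodZ.
pose K : set M := [set a | L (z *: a)].
have sK : submod K.
  split=> [|a b|r a]; rewrite /K /=; first by rewrite scaler0; apply: submod0.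
    by rewrite scalerDr; apply: submodD.
  by rewrite scaler_swap; apply: submodZ.
suff : K `<=` L by [].
refine (nakayama lm (noeM sK) sL my _) => a Ka.
have [|b Lb] := nz a; first exact: sub_add_multiples.
exists b => //; apply: ny; rewrite scaler_swap.
rewrite -(subKr (z *: a) (z *: (y *: b))); apply: submodB => //.
by rewrite -scalerBr; apply: submodZ.
Qed.

(** Any nonzerodivisor x lowers the depth by at most one. Compare with a regular
    sequence starting with y: since M / (L + x M) and M / (L + y M) both have
    positive depth, some z in m is a nonzerodivisor on both, and induction
    applies to M / (L + y M) with z and to M / (L + z M) with x. *)
Lemma depth_ge_exchange n L x : submod L -> m x -> nonzerodiv_mod x L ->
  depth_ge n.+1 L ->
  depth_ge n (add_multiples L x).
Proof.
elim: n L x => // n IH L x sL mx nx [y [my ny Dy]].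
have [y2 [my2 ny2 _]] := Dy.
have sLx := submod_add_multiples x sL; have sLy := submod_add_multiples y sL.
have socy := nonzerodiv_mod_socle my2 ny2;
  have socx := socle_trivial_swap sL my nx ny socy.
have [ps [prps avps]] := nonzerodiv_mod_primes sLx socx.
have [ps' [prps' avps']] := nonzerodiv_mod_primes sLy socy.
have In_cat P : List.In P (ps ++ ps') -> prime_ideal P /\ ~ (m `<=` P).
  by move=> /(List.in_app_or ps ps') [/prps|/prps'].
have [||z mz avz] := @coset_prime_avoidance (ps ++ ps') m 0 (is_local_ideal lm).
- by move=> P /In_cat [].
- by move=> P /In_cat [].
have nzx : nonzerodiv_mod z (add_multiples L x).
  by apply: avps => P Pps; rewrite -(add0r z); apply/avz/(List.in_or_app ps);
    left.
have nzy : nonzerodiv_mod z (add_multiples L y).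
  by apply: avps' => P Pps; rewrite -(add0r z);
    apply/avz/(List.in_or_app ps); right.
have [nz nyz] := nonzerodiv_mod_permute sL my ny nzy.
have [_ nxz] := nonzerodiv_mod_permute sL mx nx nzx.
exists z; split=> //; rewrite add_multiplesC; apply: (IH) => //;
  first exact: submod_add_multiples.
by exists y; split=> //; rewrite add_multiplesC; apply: IH.
Qed.

End Avoidance.

(** * Submodules of free modules over regular local rings *)

(** A relation with a unit coefficient makes one generator redundant. *)
Lemma drop_generator (R : comNzRingType) (M : lmodType R) k
    (phi : {linear 'rV[R]_k.+1 -> M}) (c : 'rV[R]_k.+1) i b :
  phi c = 0 -> b * c 0 i = 1 ->
  forall x, exists y : 'rV[R]_k, phi x = phi (y *m row' i 1%:M).
Proof.
move=> phic bc x; pose e := x - (x 0 i * b) *: c.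
have ei : e 0 i = 0 by rewrite !mxE -mulrA bc mulr1 subrr.
exists (col' i e).
have -> : col' i e *m row' i 1%:M = e.
  apply/rowP => j; rewrite -[in RHS](mulmx1 e) !mxE [in RHS](bigD1_ord i) //=
    ei mul0r add0r.
  by apply: eq_bigr => t _; rewrite !mxE.
by rewrite linearB linearZ /= phic scaler0 subr0.
Qed.

Lemma lspan_rows (R : comNzRingType) k l (b : 'M[R]_(k, l)) (z : 'rV[R]_l) :
  (exists c : 'rV[R]_k, z = c *m b) <-> lspan (fun i => row i b) z.
Proof.
split=> [[c ->]|[c ->]]; first by exists (fun i => c 0 i);
  rewrite mulmx_sum_row.
exists (\row_i c i); rewrite mulmx_sum_row; apply: eq_bigr => i _.
by rewrite mxE.
Qed.

(** Z has a basis, namely the rows of b. *)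
Definition free_submod (R : comNzRingType) l (Z : set 'rV[R]_l) :=
  exists k (b : 'M[R]_(k, l)),
    (forall z, Z z <-> exists c : 'rV_k, z = c *m b) /\
    forall c : 'rV_k, c *m b = 0 -> c = 0.

Lemma submod_ker (R : comNzRingType) k l (b : 'M[R]_(k, l)) :
  submod [set c : 'rV[R]_k | c *m b = 0].
Proof.
split=> [|c d|r c] /=; first by rewrite mul0mx.
  by rewrite mulmxDl => -> ->; rewrite addr0.
by rewrite -scalemxAl => ->; rewrite scaler0.
Qed.

Lemma submod_0 (R : comNzRingType) (M : lmodType R) : submod [set (0 : M)].
Proof. by split=> [|_ _ -> ->|r _ ->]//=; rewrite ?addr0 ?scaler0. Qed.

Section Domain.
Variables (R : comNzRingType) (m : set R).
Hypotheses (lm : is_local m) (domR : prime_ideal [set (0 : R)]).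

(** In a domain, relations divisible by x come from relations, so the module K
    of relations satisfies K = x K and vanishes by Nakayama. *)
Lemma injective_of_divisible x k l (b : 'M[R]_(k, l)) : m x ->
  (forall c : 'rV_k, c *m b = 0 -> exists c', c = x *: c') ->
  forall c : 'rV_k, c *m b = 0 -> c = 0.
Proof.
move=> mx div.
suff H : [set c : 'rV_k | c *m b = 0] `<=` [set 0] by move=> c /H.
refine (nakayama (K := [set c : 'rV_k | c *m b = 0]) (L := [set 0])
  lm (noetherian_module_rV (is_local_noetherian lm) (submod_ker b)) (submod_0
    _) mx _) => c /= cb.
have [c' cE] := div c cb.
have [x0|x0] := pselect (x = 0).
  by exists 0; rewrite ?mul0mx //= cE x0 !scale0r subr0.
exists c'; last by rewrite cE subrr.
apply/rowP => j; rewrite mxE; have := cb; rewrite cE -scalemxAl.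
move=> /(congr1 (fun a : 'rV_l => a 0 j)); rewrite !mxE => H.
by have [_ _ /(_ _ _ H) []] := domR.
Qed.

End Domain.

(** The relations of a minimal system of generators have their coefficients in
    m, which is principal. *)
Lemma free_of_regular_dim1 (R : comNzRingType) (m : set R) l
    (Z : set 'rV[R]_l) :
  regular_local m 1 -> submod Z -> free_submod Z.
Proof.
move=> rR sZ; have [lm _ [g mE]] := rR.
(* A system of generators of least cardinality. *)
pose P k := `[< exists b : 'M[R]_(k, l),
  forall z, Z z <-> exists c : 'rV_k, z = c *m b >].
have exP : exists k, P k.
  have [k [z zE]] := noetherian_module_rV (is_local_noetherian lm) sZ.
  exists k; apply/asboolP; exists (\matrix_i z i) => y; rewrite lspan_rows zE.
  by rewrite (_ : (fun i => row i (\matrix_i z i)) = z) //;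
    apply/funext => i; rewrite rowK.
case: (ex_minnP exP) => k /asboolP [b bE] kmin; exists k, b; split=> //.
have mg : m (g ord0) by rewrite mE; apply: mem_lspan.
apply: (injective_of_divisible lm (regular_local_domain rR) mg) => c cb.
have mc i : m (c 0 i).
  apply: contrapT => /(is_local_unit lm) [u uc].
  case: k => [|k] in b bE kmin c cb i uc *; first by case: i {uc}.
  suff /kmin : P k by rewrite ltnn.
  apply/asboolP; exists (row' i 1%:M *m b) => z; rewrite bE; split=> -[d ->].
    have [y yE] := drop_generator (phi := mulmxr b) cb uc d.
    by exists y; rewrite mulmxA.
  by exists (d *m row' i 1%:M); rewrite mulmxA.
have H i : exists d, c 0 i = g ord0 * d.
  by have := mc i; rewrite mE => -[d ->]; exists (d ord0);
    rewrite big_ord1 mulrC.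
have [d dE] := choice H; exists (\row_i d i); apply/rowP => i.
by rewrite dE !mxE.
Qed.

Section Lift.
Variables (R T : comNzRingType) (q : {rmorphism R -> T}).
Hypothesis q_surj : forall t, exists a, q a = t.

Lemma map_mx_surj k l (B : 'M[T]_(k, l)) : exists A, map_mx q A = B.
Proof.
have H (p : 'I_k * 'I_l) : exists a, q a = B p.1 p.2 by apply: q_surj.
have [f fP] := choice H; exists (\matrix_(i, j) f (i, j)).
by apply/matrixP => i j; rewrite !mxE fP.
Qed.

Variable x : R.
Hypothesis q_ker : forall a, q a = 0 -> exists b, a = b * x.

Lemma map_mx_ker k l (A : 'M[R]_(k, l)) : map_mx q A = 0 ->
  exists B, A = x *: B.
Proof.
move=> A0; have H (p : 'I_k * 'I_l) : exists b, A p.1 p.2 = b * x.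
  apply: q_ker; have := congr1 (fun B : 'M_(k, l) => B p.1 p.2) A0.
  by rewrite !mxE.
have [f fP] := choice H; exists (\matrix_(i, j) f (i, j)).
by apply/matrixP => i j; rewrite !mxE mulrC -fP.
Qed.

Lemma submod_map l (L : set 'rV[R]_l) : submod L -> submod (map_mx q @` L).
Proof.
move=> sL; split=> [|_ _ [a La <-] [b Lb <-]|t _ [a La <-]].
- by exists 0; rewrite ?map_mx0 //; apply: submod0.
- by exists (a + b); rewrite ?map_mxD //; apply: submodD.
- by have [r <-] := q_surj t; exists (r *: a); rewrite ?map_mxZ //;
  apply: submodZ.
Qed.

Lemma map_mxE l (L : set 'rV[R]_l) a : submod L -> (forall b, L (x *: b)) ->
  (map_mx q @` L) (map_mx q a) <-> L a.
Proof.
move=> sL Lx; split=> [[b Lb /esym/eqP]|La]; last by exists a.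
rewrite -subr_eq0 -map_mxB => /eqP/map_mx_ker [c ac].
by apply: (submod_trans sL _ Lb); rewrite ac.
Qed.

Lemma depth_ge_map m l n (L : set 'rV[R]_l) : submod L ->
  (forall b, L (x *: b)) ->
  depth_ge m n L -> depth_ge (q @` m) n (map_mx q @` L).
Proof.
elim: n L => //= n IH L sL Lx [y [my ny D]].
exists (q y); split; first by exists y.
  move=> t; have [a <-] := map_mx_surj t.
  by rewrite -map_mxZ !map_mxE //; apply: ny.
have -> : add_multiples (map_mx q @` L) (q y) = map_mx q @` (add_multiples L y).
  apply/seteqP; split=> [t|_ [b [a Lab] <-]].
    have [b <-] := map_mx_surj t => -[s]; have [a <-] := map_mx_surj s.
    by rewrite -map_mxZ -map_mxB map_mxE // => Lab; exists b => //; exists a.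
  by exists (map_mx q a); rewrite -map_mxZ -map_mxB map_mxE.
by apply: IH => //; [apply: submod_add_multiples|move=> b;
  apply: sub_add_multiples].
Qed.

End Lift.

(** As x is a nonzerodivisor modulo Z, the image of Z over R / (x) is Z / x Z.
    A basis of it lifts to generators of Z by Nakayama, and relations between
    the lifts are divisible by x. *)
Lemma free_submod_lift (R T : comNzRingType) (q : {rmorphism R -> T})
    (m : set R) x l (Z : set 'rV[R]_l) :
  (forall t, exists a, q a = t) ->
  (forall a, q a = 0 -> exists b, a = b * x) -> q x = 0 ->
  is_local m -> prime_ideal [set (0 : R)] -> m x -> submod Z ->
    nonzerodiv_mod x Z ->
  free_submod (map_mx q @` Z) -> free_submod Z.
Proof.
move=> qs qk qx lm domR mx sZ nx [k [B [BE Binj]]].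
have H i : exists z, Z z /\ map_mx q z = row i B.
  have /BE [z Zz zE] : exists c : 'rV_k, row i B = c *m B.
    by exists (delta_mx 0 i); rewrite rowE.
  by exists z.
have [z zP] := choice H; pose b := \matrix_i z i.
have bB : map_mx q b = B.
  by apply/row_matrixP => i; rewrite -map_row rowK; case: (zP i).
have Zb c : Z (c *m b).
  rewrite mulmx_sum_row; apply: submod_sum => // i; apply: submodZ => //.
  by rewrite rowK; case: (zP i).
exists k, b; split; last first.
  apply: (injective_of_divisible lm domR mx) => c cb.
  have /(map_mx_ker qk) : map_mx q c = 0; last by [].
  by apply: Binj; rewrite -bB -map_mxM cb map_mx0.
suff H' : Z `<=` [set y | exists c : 'rV_k, y = c *m b].
  by move=> y; split=> [/H'|[c ->]].
apply: (nakayama (K := Z) (L := [set y | exists c : 'rV_k, y = c *m b]) lm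
  (noetherian_module_rV (is_local_noetherian lm) sZ) _ mx).
  have -> : [set y | exists c : 'rV_k, y = c *m b] = lspan (fun i => row i b).
    by apply/seteqP; split=> a /lspan_rows.
  exact: submod_lspan.
move=> a Za; have [C aC] : exists C : 'rV_k, map_mx q a = C *m B.
  by apply/BE; exists a.
have [c cC] := map_mx_surj qs C.
have [|d dE] := map_mx_ker qk (A := a - c *m b).
  by rewrite map_mxB map_mxM cC bB aC subrr.
exists d; last by exists c; rewrite -dE subKr.
by apply: nx; rewrite -dE; apply: submodB.
Qed.

(** The case of the Auslander-Buchsbaum formula that is needed: if R^l / Z has
    depth at least dim R - 1, its projective dimension is at most one.
    Induction on the dimension n.+1, dividing by an x that is a nonzerodivisor
    modulo Z and belongs to a minimal system of generators of m, so that
    R / (x) is again regular. *)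
Theorem free_of_depth_quotient n (R : comNzRingType) (m : set R) l
    (Z : set 'rV[R]_l) :
  regular_local m n.+1 -> submod Z -> depth_ge m n Z -> free_submod Z.
Proof.
elim: n R m l Z => [|n IH] R m l Z rR sZ DZ;
  first exact: free_of_regular_dim1 rR sZ.
have [lm _ [g mE]] := rR; have noeR := is_local_noetherian lm;
  have noeM := @noetherian_module_rV R l noeR.
have [y [my ny _]] := DZ.
have [ps [prps avps]] := nonzerodiv_mod_primes noeR noeM sZ
  (nonzerodiv_mod_socle my ny).
have mg i : m (g i) by rewrite mE; apply: mem_lspan.
have sm := ideal_submod (is_local_ideal lm).
(* Changing g 0 by a combination x = g 0 + j with the other generators keeps a
   system of generators, and avoids primes that do not contain m. *)
pose J : set R := lspan (fun i => g (lift ord0 i) : R^o).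
have Jm : J `<=` m by apply: (lspan_sub (L := (m : set R^o)) sm) => i;
  apply: mg.
have [|||j Jj avj] := @coset_prime_avoidance R ps J (g ord0).
- exact: (submod_lspan (fun i => g (lift ord0 i) : R^o)).
- by move=> P /prps [].
- move=> P Pps Pg JP; have [prP nmP] := prps _ Pps; apply: nmP.
  rewrite mE => _ /(lspan_lift ord0) [b [c ->]].
  apply: (submodD (prime_submod prP)); first exact: (submodZ _ (prime_submod
    prP)).
  by apply: JP; exists c.
set x := g ord0 + j in avj.
have mx : m x by apply: (submodD sm); [exact: mg|exact: Jm].
have nx : nonzerodiv_mod x Z by apply: avps.
have [T [q [qs qk qx]]] := principal_quotient (is_local_nonunit lm mx).
have rT : regular_local (q @` m) n.+1.
  apply: (regular_local_image (g := fun i =>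
    g (lift ord0 i)) qs qk qx rR mx) => // a.
  rewrite mE => /(lspan_lift ord0) [b [c ->]]; case: Jj => d jE.
  exists b, (fun i => c i - b * d i); rewrite /x jE mulrDr -addrA;
    congr (_ + _).
  rewrite mulr_sumr -big_split; apply: eq_bigr => i _ /=.
  by rewrite /GRing.scale /= mulrBl mulrA addrC subrK.
apply: (free_submod_lift qs qk qx lm (regular_local_domain rR) mx sZ nx).
have sZx := submod_add_multiples x sZ.
have -> : map_mx q @` Z = map_mx q @` (add_multiples Z x).
  apply/seteqP; split; first by apply: image_subset => z;
    apply: sub_add_multiples.
  move=> _ [a [b Zab] <-]; exists (a - x *: b) => //.
  by rewrite map_mxB map_mxZ qx scale0r subr0.
apply: (IH _ _ _ _ rT); first exact: submod_map.
apply: (depth_ge_map qs qk) => //.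
  by move=> b; apply: mem_add_multiples.
exact: (depth_ge_exchange noeR noeM lm sZ mx nx DZ).
Qed.

(** * Minimal free covers *)

Section Isos.
Variable R : comNzRingType.

Lemma linear_map_of_linear (U V : lmodType R) (h : U -> V) :
  linear h -> exists phi : {linear U -> V}, forall x, phi x = h x.
Proof.
move=> h_lin; pose hL := GRing.isLinear.Build R U V _ h h_lin.
by exists (HB.pack h hL : {linear U -> V}).
Qed.

Lemma lmod_iso_of (U V : lmodType R) (h : U -> V) :
  linear h -> injective h -> (forall y, exists x, h x = y) -> lmod_iso U V.
Proof.
move=> /linear_map_of_linear [phi phiE] hinj hsurj; have [f fP] := choice hsurj.
exists phi; exists f => x; last by rewrite phiE.
by apply: hinj; rewrite fP phiE.
Qed.

Lemma lmod_iso_sym (U V : lmodType R) : lmod_iso U V -> lmod_iso V U.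
Proof.
move=> [phi [f fK Kf]]; apply: (lmod_iso_of (h := f)).
- move=> a x y; apply: (can_inj fK); rewrite linearP !Kf //.
- exact: can_inj Kf.
- by move=> y; exists (phi y).
Qed.

Lemma lmod_iso_trans (U V W : lmodType R) :
  lmod_iso U V -> lmod_iso V W -> lmod_iso U W.
Proof.
move=> [phi phiB] [chi chiB]; apply: (lmod_iso_of (h := chi \o phi)).
- by move=> a x y /=; rewrite !linearP.
- exact: inj_comp (bij_inj chiB) (bij_inj phiB).
- have [f _ fK] := phiB; have [g _ gK] := chiB.
  by move=> y; exists (f (g y)); rewrite /= fK gK.
Qed.

Lemma kernelP (U V : lmodType R) (phi : {linear U -> V}) (x : kernel phi) :
  phi (val x) = 0.
Proof. by apply/eqP; case: x. Qed.

Lemma kernel_val_linear (U V : lmodType R) (phi : {linear U -> V}) a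
    (x y : kernel phi) : val (a *: x + y) = a *: val x + val y.
Proof. by []. Qed.

Lemma kernel_ex (U V : lmodType R) (phi : {linear U -> V}) (x : U) :
  phi x = 0 -> exists k : kernel phi, val k = x.
Proof.
by move=> /eqP x0; have x0' : x \in in_ker phi := x0; exists (Kernel x0').
Qed.

Lemma lift_along_surjection (M N : lmodType R) k (phi : {linear 'rV[R]_k -> M})
    (chi : {linear N -> M}) : range chi = setT ->
  exists th : {linear 'rV[R]_k -> N}, forall c, chi (th c) = phi c.
Proof.
move=> chis.
have H i : exists n, chi n = phi (delta_mx 0 i).
  have : setT (phi (delta_mx 0 i)) by [].
  by rewrite -chis => -[n _ <-]; exists n.
have [n nP] := choice H.
have [|th thE] := @linear_map_of_linear 'rV[R]_k N (fun c =>
  \sum_i c 0 i *: n i).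
  move=> a x y; rewrite scaler_sumr -big_split /=.
  by apply: eq_bigr => i _; rewrite !mxE scalerDl scalerA.
exists th => c; rewrite thE [c in RHS]row_sum_delta !linear_sum /=.
by apply: eq_bigr => i _; rewrite !linearZ /= nP.
Qed.

End Isos.

Section MinimalCovers.
Variables (R : comNzRingType) (m : set R) (lm : is_local m).

(** Otherwise one generator could be dropped. *)
Lemma minimal_cover_ker_entries (M : lmodType R) k
    (phi : {linear 'rV[R]_k -> M}) c i :
  minimal_free_cover phi -> phi c = 0 -> m (c 0 i).
Proof.
move=> [phis phimin] phic; apply: contrapT => /(is_local_unit lm) [b bc].
case: k => [|k] in phi phis phimin c i phic bc *; first by case: i {bc}.
suff : (k.+1 <= k)%N by rewrite ltnn.
apply: (phimin k (phi \o mulmxr (row' i 1%:M))).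
apply/seteqP; split=> // x _; have : setT x by [].
rewrite -phis => -[d _ <-]; have [y ->] := drop_generator phic bc d.
by exists y.
Qed.

(** Lift each cover through the other. The composite U T of the lifts differs
    from the identity by a matrix of relations, which has entries in m; its
    determinant is a unit, so T is invertible and maps one kernel onto the
    other. *)
Lemma minimal_cover_kernel_iso (M : lmodType R) k l
    (phi : {linear 'rV[R]_k -> M}) (psi : {linear 'rV[R]_l -> M}) :
  minimal_free_cover phi -> minimal_free_cover psi ->
  lmod_iso (kernel phi) (kernel psi).
Proof.
move=> phim psim; have [phis phimin] := phim; have [psis psimin] := psim.
have kl : k = l.
  by apply/eqP; rewrite eqn_leq (phimin _ psi psis) (psimin _ phi phis).
case: l / kl psi psim psis psimin {phimin} => psi psim psis _.
have [th thE] := lift_along_surjection phi psis;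
  have [et etE] := lift_along_surjection psi phis.
pose T := lin1_mx th; pose U := lin1_mx et.
have TE c : psi (c *m T) = phi c by rewrite mul_rV_lin1 thE.
have UE c : phi (c *m U) = psi c by rewrite mul_rV_lin1 etE.
have ent i j : m ((1%:M - U *m T) i j).
  have -> : (1%:M - U *m T) i j = (row i (1%:M - U *m T)) 0 j by
    rewrite [RHS]mxE.
  apply: (minimal_cover_ker_entries _ psim).
  by rewrite rowE mulmxBr mulmx1 mulmxA linearB /= TE UE subrr.
have mdet : m (\det (U *m T) - 1).
  have := det_diag_congr (fun=> 1) (is_local_ideal lm) ent.
  rewrite (_ : diag_mx _ = 1%:M); last first.
    by rewrite -diag_const_mx; congr diag_mx; apply/rowP => i; rewrite !mxE.
  by rewrite subKr big1.
have [b] := is_local_unit1D lm mdet; rewrite addrC subrK det_mulmx mulrA => bd.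
(* b inverts det (U T), so W is the inverse of T. *)
pose W := (b * \det U) *: \adj T.
have TW : T *m W = 1%:M.
  by rewrite -scalemxAr mul_mx_adj scale_scalar_mx bd.
have WT : W *m T = 1%:M.
  by rewrite -scalemxAl mul_adj_mx scale_scalar_mx bd.
have /choice [f fE] (x : kernel phi) : exists y : kernel psi,
  val y = val x *m T.
  by apply: kernel_ex; rewrite TE kernelP.
apply: (lmod_iso_of (h := f)).
- move=> a x y; apply: val_inj.
  by rewrite kernel_val_linear !fE kernel_val_linear mulmxDl scalemxAl.
- move=> x y /(congr1 val); rewrite !fE => /(congr1 (mulmx^~ W)).
  by rewrite /= -!mulmxA TW !mulmx1 => /val_inj.
- move=> y; have [|x xE] := @kernel_ex _ _ _ phi (val y *m W).
    by rewrite -TE -mulmxA WT mulmx1 kernelP.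
  by exists x; apply: val_inj; rewrite fE xE -mulmxA WT mulmx1.
Qed.

(** By Nakayama, generators of N / z N lift to generators of N. *)
Lemma minimal_cover_mod (N : lmodType R) z l (psi : {linear 'rV[R]_l -> N}) :
  fin_gen N -> m z -> minimal_free_cover psi ->
  minimal_free_cover (quot_by_pi z \o psi : {linear 'rV[R]_l -> quot_by N z}).
Proof.
move=> [r [g gN]] mz [psis psimin].
have pis : range (quot_by_pi z : N -> quot_by N z) = setT.
  apply/seteqP; split=> // x _; exists (repr (x : Quotient.quot (zmul N z)))
    => //.
  exact: quot_by_pi_surj.
split.
  apply/seteqP; split=> // x _; have : setT x by [].
  rewrite -pis => -[n _ <-]; have : setT n by [].
  by rewrite -psis => -[a _ <-]; exists a.
move=> j chi chis; have [th thE] := lift_along_surjection chi pis.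
apply: (psimin _ th).
have st : submod (range th).
  split=> [|_ _ [a _ <-] [b _ <-]|s _ [a _ <-]].
  - by exists 0; rewrite ?linear0.
  - by exists (a + b); rewrite ?linearD.
  - by exists (s *: a); rewrite ?linearZ.
apply/seteqP; split=> //.
refine (nakayama lm (ex_intro _ r (ex_intro _ g (esym gN))) st mz _) => n _.
have : setT (quot_by_pi z n) by [].
rewrite -chis => -[c _]; rewrite -thE => /esym/quot_by_piP/asboolP [y ny].
by exists y => //; exists c => //; rewrite -ny subKr.
Qed.

(** The kernel is psi^-1 (z N), an extension of z N by ker psi. As z is a
    nonzerodivisor, z N is a copy of N, and h splits the extension. *)
Lemma split_syzygy (N : lmodType R) z l (psi : {linear 'rV[R]_l -> N})
    (h : {linear N -> 'rV[R]_l}) :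
  (forall n : N, z *: n = 0 -> n = 0) -> (forall n, psi (h n) = z *: n) ->
  lmod_iso (kernel (quot_by_pi z \o psi : {linear 'rV[R]_l -> quot_by N z}))
    (N * kernel psi)%type.
Proof.
set phi := (X in kernel X) => ntor hE; apply: lmod_iso_sym.
have phi0 a : phi a = 0 <-> exists n, psi a = z *: n.
  rewrite -[0](linear0 (quot_by_pi z : {linear N -> quot_by N z})).
  by split=> [/quot_by_piP|[n an]]; [|apply/quot_by_piP];
    rewrite subr0; [move=> /asboolP|apply/asboolP; exists n].
have /choice [f fE] (x : N * kernel psi) :
    exists y : kernel phi, val y = h x.1 + val x.2.
  case: x => n x; apply: kernel_ex; apply/phi0; exists n.
  by rewrite linearD /= kernelP addr0 hE.
apply: (lmod_iso_of (h := f)).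
- move=> a x y; apply: val_inj.
  rewrite kernel_val_linear !fE [(_ + y).2]/= kernel_val_linear linearP.
  by rewrite scalerDr addrACA.
- move=> [n x] [n' x'] /(congr1 val); rewrite !fE /= => E.
  have nn' : n = n'.
    have := congr1 psi E; rewrite !linearD /= !kernelP !addr0 !hE => zn.
    by apply/subr0_eq/ntor; rewrite scalerBr zn subrr.
  by rewrite nn' in E *; congr (_, _); apply/val_inj/(addrI (h n')).
- move=> y; have /phi0 [n yn] := kernelP y.
  have [|x xE] := @kernel_ex _ _ _ psi (val y - h n).
    by rewrite linearB /= yn hE subrr.
  by exists (n, x); apply: val_inj; rewrite fE /= xE addrC subrK.
Qed.

End MinimalCovers.

(** * Matrix factorizations and derivations *)

(** A module N over A = Q / (F) whose syzygy Z over Q is free, and a derivation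
    d of Q with d F = z. *)
Section Homotopy.
Variables (Q A : comNzRingType) (pi : {rmorphism Q -> A}) (F z : Q).
Hypothesis pi_surj : forall t, exists a, pi a = t.
Hypothesis pi_F : pi F = 0.
Hypothesis domQ : prime_ideal [set (0 : Q)].
Variable d : Q -> Q.
Hypothesis dD : {morph d : a b / a + b}.
Hypothesis dM : forall a b, d (a * b) = d a * b + a * d b.
Hypothesis dF : d F = z.

Let d0 : d 0 = 0.
Proof. by apply: (@addrI _ (d 0)); rewrite -dD !addr0. Qed.

Lemma map_mx_derivation n p r (B : 'M[Q]_(n, p)) (C : 'M[Q]_(p, r)) :
  map_mx d (B *m C) = map_mx d B *m C + B *m map_mx d C.
Proof.
apply/matrixP => i j; rewrite !mxE (big_morph d dD d0) -big_split.
by apply: eq_bigr => k _; rewrite dM !mxE.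
Qed.

Variables (N : lmodType A) (l : nat) (psi : {linear 'rV[A]_l -> N}).
Hypothesis psi_surj : range psi = setT.
Let Z : set 'rV[Q]_l := [set a | psi (map_mx pi a) = 0].
Hypothesis Z_free : free_submod Z.

(** F kills N, so F Q^l lies in Z and each F e_i has coordinates in the basis
    B; the second product follows from B D B = F B. *)
Lemma matrix_factorization : exists k (B : 'M[Q]_(k, l)) (D : 'M[Q]_(l, k)),
  [/\ forall a, Z a <-> exists c : 'rV_k, a = c *m B,
      forall c : 'rV_k, c *m B = 0 -> c = 0,
      D *m B = F%:M & B *m D = F%:M].
Proof.
have [k [B [BE Binj]]] := Z_free.
have H i : exists c : 'rV_k, F *: delta_mx 0 i = c *m B.
  by apply/BE; rewrite /Z /= map_mxZ pi_F scale0r linear0.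
have [D DE] := choice H; exists k, B, (\matrix_i D i).
have DB : (\matrix_i D i) *m B = F%:M.
  by apply/row_matrixP => i; rewrite row_mul rowK -DE rowE mul_mx_scalar.
split=> //; apply/subr0_eq/row_matrixP => i; rewrite row0; apply: Binj.
rewrite -row_mul mulmxBl -mulmxA DB mul_mx_scalar mul_scalar_mx subrr.
by rewrite row0.
Qed.

(** Differentiating D B = F gives z = d(D) B + D d(B), so on Q^l multiplication
    by z agrees modulo Z with X = D d(B). Since B X = F d(B), the matrix X maps
    Z into F Q^l, so it induces a map from N to A^l. *)
Lemma scale_factors_through_free :
  exists h : {linear N -> 'rV[A]_l}, forall n, psi (h n) = pi z *: n.
Proof.
have [k [B [D [BE Binj DB BD]]]] := matrix_factorization.
pose X := D *m map_mx d B.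
have BX : map_mx pi (B *m X) = 0.
  by rewrite mulmxA BD mul_scalar_mx map_mxZ pi_F scale0r.
have zX : z%:M - X = map_mx d D *m B.
  apply/eqP; rewrite subr_eq -map_mx_derivation DB; apply/eqP/matrixP => i j.
  by rewrite !mxE; case: (i == j); rewrite /= ?mulr1n ?mulr0n ?dF ?d0.
have Xz a : psi (map_mx pi (a *m X)) = pi z *: psi (map_mx pi a).
  apply/esym/subr0_eq; rewrite -linearZ -linearB -map_mxZ -map_mxB /=.
  by apply/BE; exists (a *m map_mx d D); rewrite -mulmxA -zX mulmxBr
    mul_mx_scalar.
have XZ a : Z a -> map_mx pi (a *m X) = 0.
  by move=> /BE [c ->]; rewrite -mulmxA map_mxM BX mulmx0.
have H n : exists a, psi (map_mx pi a) = n.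
  have : setT n by []; rewrite -psi_surj => -[a' _ <-].
  by have [a <-] := map_mx_surj pi_surj a'; exists a.
have [f fE] := choice H.
have [|h hE] := @linear_map_of_linear A N 'rV[A]_l (fun n =>
  map_mx pi (f n *m X)).
  move=> s n n'; have [r rs] := pi_surj s.
  apply/subr0_eq; rewrite -rs -map_mxZ -map_mxD -map_mxB scalemxAl -mulmxDl
    -mulmxBl.
  apply: XZ; rewrite /Z /= map_mxB map_mxD map_mxZ linearB linearD linearZ /=.
  by rewrite !fE rs subrr.
by exists h => n; rewrite hE Xz fE.
Qed.

(** If z a = c B lies in Z, multiply by D: the entries of F c are divisible by
    z, hence so are those of c. *)
Lemma scale_torsion_free : z <> 0 ->
  (forall c w, F * c = z * w -> exists c', c = z * c') ->
  forall n : N, pi z *: n = 0 -> n = 0.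
Proof.
move=> z0 Fz n zn; have [k [B [D [BE Binj DB BD]]]] := matrix_factorization.
have : setT n by []; rewrite -psi_surj => -[a' _ an].
have [a aE] := map_mx_surj pi_surj a'; rewrite -an -aE in zn *.
have /BE [c cE] : Z (z *: a) by rewrite /Z /= map_mxZ linearZ.
have H i : exists c', c 0 i = z * c'.
  apply: (Fz _ ((a *m D) 0 i)).
  have := congr1 (fun x => (x *m D) 0 i) cE.
  by rewrite /= -mulmxA BD mul_mx_scalar -scalemxAl !mxE.
have [c' c'E] := choice H.
apply/BE; exists (\row_i c' i); apply/subr0_eq/rowP => i.
have E : z *: (a - (\row_i c' i) *m B) = 0.
  rewrite scalerBr cE scalemxAl (_ : z *: _ = c) ?subrr //.
  by apply/rowP => j; rewrite !mxE.
have := congr1 (fun x : 'rV_l => x 0 i) E; rewrite !mxE => zi.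
by have [_ _ /(_ _ _ zi) []] := domQ.
Qed.

End Homotopy.

Section Derivation.
Variable R : comNzRingType.
Implicit Types f g : powser R.

Definition ps_deriv f : powser R := fun n => f n.+1 *+ n.+1.

Lemma ps_derivD : {morph ps_deriv : f g / f + g}.
Proof. by move=> f g; apply/funext => n; apply: mulrnDl. Qed.

Lemma ps_deriv0 : ps_deriv 0 = 0.
Proof. by apply: (@addrI _ (ps_deriv 0)); rewrite -ps_derivD !addr0. Qed.

Lemma ps_derivM f g : ps_deriv (f * g) = ps_deriv f * g + f * ps_deriv g.
Proof.
apply/funext => n; rewrite /ps_deriv ps_coefD !ps_coefM.
(* Split the factor n.+1 as i + (n.+1 - i). *)
have -> : (\sum_(i < n.+2) f i * g (n.+1 - i)%N) *+ n.+1 =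
    \sum_(i < n.+2) f i *+ i * g (n.+1 - i)%N +
    \sum_(i < n.+2) f i * (g (n.+1 - i)%N *+ (n.+1 - i)).
  rewrite -sumrMnl -big_split; apply: eq_bigr => i _ /=.
  by rewrite mulrnAl mulrnAr -mulrnDr subnKC // -ltnS.
congr (_ + _); first by rewrite big_ord_recl mulr0n mul0r add0r.
rewrite big_ord_recr /= subnn mulr0n mulr0 addr0; apply: eq_bigr => i _.
by rewrite subSn // -ltnS.
Qed.

Lemma ps_derivC (c : R) : ps_deriv (psC c) = 0.
Proof. by apply/funext => n; rewrite /ps_deriv /psC /= mul0rn. Qed.

Lemma ps_derivX : ps_deriv psX = 1.
Proof. by apply/funext => -[|n]; rewrite /ps_deriv /psX /= ?mul0rn. Qed.

End Derivation.

Section Derivation2.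
Variable S : comNzRingType.
Let Q := powser2 S.
Implicit Types a b : Q.

(** The derivative with respect to u; that with respect to v is ps_deriv over
    S[[u]]. *)
Definition ps2_du a : Q := fun j => ps_deriv (a j).

Lemma ps2_duD : {morph ps2_du : a b / a + b}.
Proof. by move=> a b; apply/funext => j; apply: ps_derivD. Qed.

Lemma ps2_duM a b : ps2_du (a * b) = ps2_du a * b + a * ps2_du b.
Proof.
apply/funext => j; rewrite /ps2_du ps_coefD !ps_coefM.
rewrite (big_morph _ (@ps_derivD S) (@ps_deriv0 S)) -big_split.
by apply: eq_bigr => i _; rewrite ps_derivM.
Qed.

Lemma ps2_du_eqn (f : S) : ps2_du (hyp_eqn f) = ps2_v S.
Proof.
apply/funext => j; rewrite /ps2_du /hyp_eqn ps_coefD ps_derivD.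
have -> : ps_deriv (ps2C f j) = 0.
  by rewrite /ps2C /psC; case: j => [|j]; [exact: ps_derivC|exact: ps_deriv0].
rewrite add0r [_ j]ps_coefCM ps_derivM ps_derivX mul1r /ps2_v /psX.
by case: (j == 1%N); rewrite ?(ps_derivC 1) ?ps_deriv0 mulr0 addr0.
Qed.

Lemma ps2_dv_eqn (f : S) : ps_deriv (hyp_eqn f) = ps2_u S.
Proof.
rewrite /hyp_eqn ps_derivD ps_derivM [ps_deriv (ps2C f)]ps_derivC.
rewrite [ps_deriv (ps2_u S)]ps_derivC.
by rewrite [ps_deriv (ps2_v S)]ps_derivX mul0r mulr1 !add0r.
Qed.

Hypothesis domS : prime_ideal [set (0 : S)].

(** Modulo v, as modulo u, the equation becomes f, a nonzero element of the
    domain S. *)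
Lemma eqn_regular_mod_v (f : S) (c w : Q) : f <> 0 ->
  hyp_eqn f * c = ps2_v S * w -> exists c', c = ps2_v S * c'.
Proof.
move=> f0 E; apply: psX_divides; apply/funext => i.
have := congr1 (fun a : Q => a 0%N i) E; rewrite /hyp_eqn.
rewrite (ps_coef0M (_ : powser (powser S))).
rewrite (ps_coef0M (ps2_v S : powser (powser S))).
rewrite ps_coefD (ps_coef0M (ps2_u S : powser (powser S))) /ps2_v /psX /=
  mulr0 addr0 mul0r.
rewrite ps_coefCM => fc; by have [_ _ /(_ _ _ fc) []] := domS.
Qed.

Lemma eqn_regular_mod_u (f : S) (c w : Q) : f <> 0 ->
  hyp_eqn f * c = ps2_u S * w -> exists c', c = ps2_u S * c'.
Proof.
move=> f0 E; have H j : exists c', c j = psX * c'.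
  apply: psX_divides; have := congr1 (fun a : Q => a j 0%N) E.
  rewrite /hyp_eqn mulrDl -mulrA !ps_coefD !(ps_coefCM _ _ j) !ps_coefXM
    ps_coefCM addr0 => fc.
  by have [_ _ /(_ _ _ fc) []] := domS.
have [c' c'E] := choice H; exists c'; apply/funext => j.
by rewrite ps_coefCM.
Qed.

End Derivation2.

(** * The hypersurface S[[u,v]]/(f + uv) *)

Section Depth.
Variables (R : comNzRingType) (M : lmodType R).

(** Families indexed by nat, as the length of the sequence will vary. *)
Lemma seq_mulP (s : seq R) (x : M) : seq_mul s x <->
  exists y : nat -> M, x = \sum_(i < size s) s`_i *: y i.
Proof.
split=> [[y ->]|[y ->]]; last by exists (fun i => y i).
exists (fun n => if insub n is Some i then y i else 0).
by apply: eq_bigr => i _; rewrite valK.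
Qed.

Lemma seq_mul_rcons (s : seq R) r (x : M) :
  seq_mul (rcons s r) x <-> exists n, seq_mul s (x - r *: n).
Proof.
rewrite seq_mulP size_rcons; split=> [[y ->]|[n /seq_mulP [y E]]].
  exists (y (size s)); apply/seq_mulP; exists y.
  rewrite big_ord_recr /= nth_rcons ltnn eqxx addrK.
  by apply: eq_bigr => i _; rewrite nth_rcons ltn_ord.
exists (fun i => if (i < size s)%N then y i else n).
rewrite big_ord_recr /= ltnn nth_rcons ltnn eqxx -[LHS](subrK (r *: n)) E.
by congr (_ + _); apply: eq_bigr => i _; rewrite nth_rcons ltn_ord.
Qed.

Variables (Q : comNzRingType) (pi : {rmorphism Q -> R}).
Hypothesis pi_surj : forall t, exists a, pi a = t.
Variables (mQ : set Q) (mR : set R).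
Hypothesis mQR : forall a, mR (pi a) -> mQ a.
Variables (l : nat) (psi : {linear 'rV[R]_l -> M}).
Hypothesis psi_surj : range psi = setT.

(** A regular sequence on M, lifted to Q, is a regular sequence on the
    presentation of M as a quotient of Q^l. *)
Lemma depth_ge_of_regular_seq s n : regular_seq mR M s -> (n <= size s)%N ->
  depth_ge mQ n [set a : 'rV[Q]_l | psi (map_mx pi a) = 0].
Proof.
move=> [ms nzs _] ns.
pose Z i : set 'rV[Q]_l := [set a | seq_mul (take i s) (psi (map_mx pi a))].
have -> : [set a : 'rV[Q]_l | psi (map_mx pi a) = 0] = Z 0%N.
  apply/seteqP; split=> a; rewrite /Z /= take0.
    by move=> ->; exists (fun=> 0); rewrite big_ord0.
  by move=> [y ->]; rewrite big_ord0.
suff H i : (i + n <= size s)%N -> depth_ge mQ n (Z i) by apply: H.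
elim: n i {ns} => [//|n IH] i /=; rewrite addnS => ins.
have is_ : (i < size s)%N by rewrite (leq_trans _ ins) // ltnS leq_addr.
have [y ys] := pi_surj s`_i; exists y; split.
- by apply: mQR; rewrite ys; apply: ms.
- by move=> a; rewrite /Z /= map_mxZ linearZ /= ys; apply: nzs.
have -> : add_multiples (Z i) y = Z i.+1.
  apply/seteqP; split=> a; rewrite /Z /= (take_nth 0) // seq_mul_rcons.
    move=> [b]; rewrite /= map_mxB map_mxZ linearB linearZ /= ys => H.
    by exists (psi (map_mx pi b)).
  move=> [x]; have : setT x by []; rewrite -psi_surj => -[b' _ <-].
  have [b <-] := map_mx_surj pi_surj b'; rewrite -ys -linearZ -linearB /=.
  by rewrite -map_mxZ -map_mxB => H; exists b.
by apply: IH; rewrite addSn.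
Qed.

End Depth.

Section HypersurfaceCover.
Variables (S : comNzRingType) (n : set S) (f : S).
Hypotheses (nloc : local_ring n) (fn2 : ideal_pow n 2 f).
Notation Q := (powser2 S).
Notation A := (hypersurface nloc fn2).
Let pi : {rmorphism Q -> A} := hyp_pi nloc fn2.
Let m : set Q := const_coef_in (const_coef_in n).

Lemma hyp_pi_surj (t : A) : exists a, pi a = t.
Proof.
exists (repr (t : {ideal_quot (principal (hyp_eqn_nonunit nloc fn2))})).
exact: reprK.
Qed.

Lemma hyp_pi_ker (a : Q) : pi a = 0 -> exists b, a = b * hyp_eqn f.
Proof.
by rewrite -(rmorph0 pi) => /hyp_piP [b]; rewrite subr0 => ->; exists b.
Qed.

Lemma hyp_pi_eqn : pi (hyp_eqn f) = 0.
Proof.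
rewrite -(rmorph0 pi); apply/hyp_piP; exists 1.
by rewrite subr0 mul1r.
Qed.

Lemma ideal_pow2_mem : n f.
Proof.
have hn := is_local_ideal (is_local_of_local_ring nloc); have [n0 nD nM] := hn.
have [k [x [y [xn _ ->]]]] := fn2.
by elim/big_ind: _ => // i _; apply: ideal_mulr.
Qed.

Lemma hyp_eqn_mem : m (hyp_eqn f).
Proof.
rewrite /m /const_coef_in /= /hyp_eqn ps_coefD (ps_coef0M (ps2_u S : powser
  (powser S))).
by rewrite /ps2_v /psX /= mulr0 addr0; apply: ideal_pow2_mem.
Qed.

(** Dividing by one element lowers the dimension by at most one. *)
Lemma hypersurface_prime_chain d : regular_local m d.+1 -> prime_chain A d.
Proof.
move=> [lm [P0 c] _].
have [P1 [P1F _ c1]] := chain_between_through (is_local_noetherian lm) c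
  hyp_eqn_mem.
exact (prime_chain_of_chain_between (chain_between_image hyp_pi_surj
  hyp_pi_ker c1 P1F)).
Qed.

Lemma hyp_pi_maximal mA a : is_local m -> is_local mA -> mA (pi a) <-> m a.
Proof.
move=> lm lA; have [hA A1] : is_ideal mA /\ ~ mA 1 by case: lA.
split=> [Aa|ma].
  have := @proper_ideal_sub _ m (pi @^-1` mA) lm; apply=> //; last first.
    by rewrite /= rmorph1.
  have [A0 AD AM] := hA; split=> [|x y|x y] /=; first by rewrite rmorph0.
    by rewrite rmorphD; apply: AD.
  by rewrite rmorphM; apply: AM.
apply: contrapT => /(is_local_unit lA) [b]; have [b' <-] := hyp_pi_surj b.
rewrite -rmorphM -(rmorph1 pi) => /hyp_piP [c E].
have [_ hm m1 _] := lm; apply: m1.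
rewrite -(subKr (b' * a) 1) E; apply: (submodB (ideal_submod hm)).
  exact: ideal_mull.
by apply: ideal_mull => //; apply: hyp_eqn_mem.
Qed.

End HypersurfaceCover.

Local Close Scope classical_set_scope.

Theorem corollary1p2 (S : comNzRingType) (n : set S)
    (nloc : local_ring n) (nreg : regular n) (ncpl : adic_complete n)
    (f : S) (f_neq0 : f != 0) (fn2 : ideal_pow n 2 f)
    (N : lmodType (hypersurface nloc fn2)) (N_MCM : maximal_CM N)
    (z : hypersurface nloc fn2)
    (z_uv : z = hyp_u nloc fn2 \/ z = hyp_v nloc fn2)
    (k l : nat)
    (phi : {linear 'rV[hypersurface nloc fn2]_k -> quot_by N z})
    (psi : {linear 'rV[hypersurface nloc fn2]_l -> N})
    (phi_min : minimal_free_cover phi) (psi_min : minimal_free_cover psi) :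
  lmod_iso (kernel phi) (N * kernel psi)%type.
Proof.
have /eqP f0 := f_neq0.
have [d rS] := regular_local_of_regular nloc nreg.
have domS := regular_local_domain rS.
pose m : set (powser2 S) := const_coef_in (const_coef_in n).
have rQ : regular_local m d.+2 := ps_regular_local (ps_regular_local rS).
have domQ := regular_local_domain rQ.
have lQ : is_local m by case: rQ.
have [fgN [mA [dA [locA [_ dAmax] [[s [regs sz]] _]]]]] := N_MCM.
have lA := is_local_of_local_ring locA.
(* The dimension of A is the depth of N, and d.+1 is the dimension of Q minus
   one. *)
have dle : (d.+1 <= dA)%N.
  by apply: dAmax; exact (hypersurface_prime_chain nloc fn2 rQ).
subst dA.
pose pi : {rmorphism powser2 S -> hypersurface nloc fn2} := hyp_pi nloc fn2.
have pis : forall t, exists a, pi a = t := @hyp_pi_surj S n f nloc fn2.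
have [psis _] := psi_min.
pose Z : set 'rV[powser2 S]_l := [set a | psi (map_mx pi a) = 0]%classic.
have sZ : submod Z.
  split=> [|a b|r a]; rewrite /Z /=; first by rewrite map_mx0 linear0.
    by rewrite map_mxD linearD /= => -> ->; rewrite addr0.
  by rewrite map_mxZ linearZ /= => ->; rewrite scaler0.
have freeZ : free_submod Z.
  apply: (free_of_depth_quotient rQ sZ).
  apply: (depth_ge_of_regular_seq pis _ psis regs dle) => a.
  by move/(hyp_pi_maximal _ lQ lA).
(* For z = u differentiate with respect to v, and conversely. *)
have [zQ [D [zE mz z0 [DD DM DF] Fz]]] : exists zQ (D : powser2 S -> powser2 S),
    [/\ z = pi zQ, m zQ, zQ <> 0,
      [/\ {morph D : a b / a + b}, forall a b, D (a * b) = D a * b + a * D b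
         & D (hyp_eqn f) = zQ] &
      forall c w, hyp_eqn f * c = zQ * w -> exists c', c = zQ * c'].
  have n0 : n 0 by case: (is_local_ideal (is_local_of_local_ring nloc)).
  case: z_uv => ->; [exists (ps2_u S), (@ps_deriv (powser S))|
    exists (ps2_v S), (@ps2_du S)].
  - split=> //.
        move=> /(congr1 (fun a : powser2 S => a 0%N 1%N)) /eqP.
        by rewrite /= oner_eq0.
      by split; [apply: ps_derivD|apply: ps_derivM|apply: ps2_dv_eqn].
    by move=> c w; apply: eqn_regular_mod_u.
  - split=> //.
        move=> /(congr1 (fun a : powser2 S => a 1%N 0%N)) /eqP.
        by rewrite /= oner_eq0.
      by split; [apply: ps2_duD|apply: ps2_duM|apply: ps2_du_eqn].
    by move=> c w; apply: eqn_regular_mod_v.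
have piF : pi (hyp_eqn f) = 0 by apply: hyp_pi_eqn.
have mAz : mA z by rewrite zE; apply/(hyp_pi_maximal _ lQ lA).
have [h hE] := scale_factors_through_free pis piF DD DM DF psis freeZ.
have ntor := scale_torsion_free pis piF domQ psis freeZ z0 Fz.
rewrite -zE in hE ntor.
have psi_mod_min := minimal_cover_mod lA fgN mAz psi_min.
apply: lmod_iso_trans (split_syzygy ntor hE).
exact (minimal_cover_kernel_iso lA phi_min psi_mod_min).
Qed.
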